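(* Let $D$ be an integral domain, let $\mathbf{X}=\{X_i\}_{i\in\Lambda}$ be a set of algebraically independent indeterminates over $D$, and set $S=D[\mathbf{X}]$ (the polynomial ring). Then $\dim S\ge\dim D+|\Lambda|$, with equality if $D$ is Noetherian. Hence if $D$ is a finitely generated algebra over a field, then $\dim S\ge\operatorname{udim} S+|\Lambda|$.
   Context: All rings are commutative and unital; $\dim$ is Krull dimension, and dimensions, $\operatorname{udim}$ and $|\Lambda|$ are regarded as elements of $\{0,1,2,\dots\}\cup\{\infty\}$ (with $|\Lambda|=\infty$ if $\Lambda$ is infinite). A ring $R$ is unit-additive if whenever $u,v$ are units of $R$, $u+v$ is either a unit of $R$ or a nilpotent element. The saturation of a multiplicative set $W\subseteq R$ is $\widetilde W=\{x\in R\mid \exists y\in R,\ xy\in W\}$. Unit dimension: let $R$ be a ring whose nilradical is a prime ideal (e.g. a domain). Set $W_0=\{1\}$ and $V_0=\widetilde{W_0}=U(R)$ (the units of $R$). For each $i\ge1$ define inductively $W_i$ to be the set of non-nilpotent (finite) sums of elements of $V_{i-1}$ (this set is multiplicatively closed) and $V_i=\widetilde{W_i}$. Then $\operatorname{udim} R$ is the smallest integer $n\ge0$ such that $W_n^{-1}R$ is unit-additive, and $\operatorname{udim} R=\infty$ if no such $n$ exists. *)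

(* Defs.v *)
From HB Require Import structures.
From mathcomp Require Import all_boot all_order all_algebra.
From mathcomp Require Import boolp classical_sets cardinality functions.
From mathcomp Require Import constructive_ereal.
From mathcomp Require Import finmap ring.
(* The notations of monalg and constructive_ereal have incompatible levels. *)
From mathcomp Require Import -(notations) monalg.

Set Implicit Arguments.
Unset Strict Implicit.
Unset Printing Implicit Defensive.

Import GRing.Theory.
Local Open Scope classical_set_scope.
Local Open Scope ring_scope.
Local Open Scope quotient_scope.

(* {0, 1, 2, ...} with infinity is embedded in [\bar int]; every value used
   below is either [+oo] or of the form [n%:Z%:E] with [n : nat]. *)

Definition ecard (T : choiceType) : \bar int :=
  if pselect (finite_set [set: T]) then (#|` fset_set [set: T]|%:Z)%:E
  else +oo%E.

(* The polynomial ring over [R] in a set of indeterminates indexed by [I]: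
   monomials are finitely supported functions [I -> nat]. *)
Definition poly_ring (R : comNzRingType) (I : choiceType) : comNzRingType :=
  malg (cmonom I) R.

Section KrullDimension.
Variable R : comNzRingType.

(* An ideal is a submodule of [R] acting on itself. *)
Definition ideal (J : set R) : Prop := submod_closed ([in J] : {pred R^o}).

(* [idealr_closed] includes properness. *)
Definition prime_ideal (P : set R) : Prop :=
  idealr_closed [in P] /\ prime_idealr_closed [in P].

Definition prime_chain (n : nat) (P : nat -> set R) : Prop :=
  (forall i, (i <= n)%N -> prime_ideal (P i)) /\
  (forall i, (i < n)%N -> P i `<` P i.+1).

Definition krull_dim : \bar int :=
  supremum 0%E [set (n%:Z)%:E | n in [set n | exists P, prime_chain n P]].

Definition noetherian : Prop :=
  forall J : set R, ideal J ->
    exists s : seq R,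
      J = [set x | exists a : nat -> R, x = \sum_(i < size s) a i * s`_i].

End KrullDimension.

(* A [k]-algebra structure on [A] is given by the structure morphism [iota]. *)
Definition finitely_generated_algebra (k : fieldType) (A : comNzRingType)
    (iota : {rmorphism k -> A}) : Prop :=
  exists (n : nat) (v : 'I_n -> A), forall x : A,
    exists p : poly_ring k 'I_n,
      x = mmap iota (fun m : cmonom 'I_n => \prod_(i < n) v i ^+ m i) p.

Section Units.
Variable R : comPzRingType.

(* Neither polynomial rings in arbitrary indeterminates nor the localizations
   below carry a [unitRingType] structure. *)
Definition is_unit (x : R) : Prop := exists y, x * y = 1.

Definition nilpotent (x : R) : Prop := exists n, x ^+ n = 0.

Definition unit_additive : Prop :=
  forall u v, is_unit u -> is_unit v -> is_unit (u + v) \/ nilpotent (u + v).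

Definition multiplicative_set (W : set R) : Prop :=
  W 1 /\ forall x y, W x -> W y -> W (x * y).

Definition saturation (W : set R) : set R := [set x | exists y, W (x * y)].

Definition nilradical_prime : Prop :=
  ~ nilpotent 1 /\ forall x y, nilpotent (x * y) -> nilpotent x \/ nilpotent y.

End Units.

(* The localization of [R] at [W], for an arbitrary [W]: denominators are finite
   products of elements of [W], which are just the elements of [W] when [W] is a
   multiplicative set (lemma [denom_id]). *)
Definition denom (R : comPzRingType) (W : set R) : set R :=
  [set w | exists2 s : seq R, {in s, forall x, W x} & w = \prod_(x <- s) x].

Lemma denom1 (R : comPzRingType) (W : set R) : denom W 1.
Proof. by exists [::]; rewrite ?big_nil. Qed.

Lemma denomM (R : comPzRingType) (W : set R) x y :
  denom W x -> denom W y -> denom W (x * y).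
Proof.
move=> [s sW ->] [t tW ->]; exists (s ++ t); last by rewrite big_cat.
by move=> z; rewrite mem_cat => /orP[/sW|/tW].
Qed.

Lemma denom_id (R : comPzRingType) (W : set R) :
  multiplicative_set W -> denom W = W.
Proof.
move=> [W1 WM]; apply/seteqP; split=> [w [s sW ->]|w Ww]; last first.
  exists [:: w]; last by rewrite big_seq1.
  by move=> x; rewrite inE => /eqP ->.
by rewrite big_seq; elim/big_ind: _ => // x /sW.
Qed.

Module Localization.
Section Localization.
Variables (R : comPzRingType) (W : set R).

Record frac := Frac { num_den :> R * R; _ : `[< denom W num_den.2 >] }.

HB.instance Definition _ := [isSub for num_den].
HB.instance Definition _ := [Choice of frac by <:].

Implicit Types x y z : frac.

Lemma fracP x : denom W x.2. Proof. by case: x => p /= /asboolP. Qed.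

Definition mkfrac (a b : R) (Wb : denom W b) : frac :=
  @Frac (a, b) (introT (asboolP _) Wb).

Definition eqf x y : bool :=
  `[< exists2 t, denom W t & t * (x.1 * y.2) = t * (y.1 * x.2) >].

Lemma eqf_refl : reflexive eqf.
Proof. by move=> x; apply/asboolP; exists 1 => //; exact: denom1. Qed.

Lemma eqf_sym : symmetric eqf.
Proof. by move=> x y; apply/asboolP/asboolP => -[t Wt e]; exists t. Qed.

Lemma eqf_trans : transitive eqf.
Proof.
move=> y x z /asboolP[t Wt et] /asboolP[u Wu eu]; apply/asboolP.
exists (t * u * y.2); first by apply: denomM (fracP y); exact: denomM.
have -> : t * u * y.2 * (x.1 * z.2) = u * z.2 * (t * (x.1 * y.2)) by ring.
rewrite et; have -> : u * z.2 * (t * (y.1 * x.2)) = t * x.2 * (u * (y.1 * z.2)).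
  by ring.
by rewrite eu; ring.
Qed.

Canonical eqf_equiv := EquivRel eqf eqf_refl eqf_sym eqf_trans.

Definition type := {eq_quot eqf}.

HB.instance Definition _ : EqQuotient _ eqf type := EqQuotient.on type.
HB.instance Definition _ := Choice.on type.

Lemma eqf_repr x : exists2 t, denom W t &
  t * ((repr (\pi_type x)).1 * x.2) = t * (x.1 * (repr (\pi_type x)).2).
Proof.
have /eqmodP/asboolP[t Wt e] : repr (\pi_type x) = x %[mod type] by rewrite reprK.
by exists t.
Qed.

Definition zerof : frac := mkfrac 0 (denom1 W).
Definition onef : frac := mkfrac 1 (denom1 W).
Definition addf x y : frac :=
  mkfrac (x.1 * y.2 + y.1 * x.2) (denomM (fracP x) (fracP y)).
Definition oppf x : frac := mkfrac (- x.1) (fracP x).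
Definition mulf x y : frac := mkfrac (x.1 * y.1) (denomM (fracP x) (fracP y)).

Definition zero : type := lift_cst type zerof.
Canonical zero_pi_morph := PiConst zero.
Definition one : type := lift_cst type onef.
Canonical one_pi_morph := PiConst one.
Definition add := lift_op2 type addf.
Definition opp := lift_op1 type oppf.
Definition mul := lift_op2 type mulf.

Lemma pi_add : {morph \pi : x y / addf x y >-> add x y}.
Proof.
move=> x y; unlock add; apply/eqmodP/asboolP.
have [t Wt et] := eqf_repr x; have [u Wu eu] := eqf_repr y.
exists (t * u); first exact: denomM.
rewrite /=; set x' := repr (\pi_type x) in et *; set y' := repr (\pi_type y) in eu *.
transitivity (u * y'.2 * y.2 * (t * (x.1 * x'.2)) +
              t * x'.2 * x.2 * (u * (y.1 * y'.2))); first by ring.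
by rewrite -et -eu; ring.
Qed.
Canonical pi_add_morph := PiMorph2 pi_add.

Lemma pi_opp : {morph \pi : x / oppf x >-> opp x}.
Proof.
move=> x; unlock opp; apply/eqmodP/asboolP.
have [t Wt et] := eqf_repr x; exists t => //=.
by rewrite !mulNr !mulrN et.
Qed.
Canonical pi_opp_morph := PiMorph1 pi_opp.

Lemma pi_mul : {morph \pi : x y / mulf x y >-> mul x y}.
Proof.
move=> x y; unlock mul; apply/eqmodP/asboolP.
have [t Wt et] := eqf_repr x; have [u Wu eu] := eqf_repr y.
exists (t * u); first exact: denomM.
rewrite /=; set x' := repr (\pi_type x) in et *; set y' := repr (\pi_type y) in eu *.
transitivity ((t * (x.1 * x'.2)) * (u * (y.1 * y'.2))); first by ring.
by rewrite -et -eu; ring.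
Qed.
Canonical pi_mul_morph := PiMorph2 pi_mul.

Lemma pi_eq x y : x.1 * y.2 = y.1 * x.2 -> \pi_type x = \pi_type y.
Proof.
move=> e; apply/eqmodP/asboolP; exists 1; first exact: denom1.
by rewrite e.
Qed.

Lemma addA : associative add.
Proof.
elim/quotW=> x; elim/quotW=> y; elim/quotW=> z.
by rewrite !piE; apply: pi_eq => /=; ring.
Qed.

Lemma addC : commutative add.
Proof.
by elim/quotW=> x; elim/quotW=> y; rewrite !piE; apply: pi_eq => /=; ring.
Qed.

Lemma add0 : left_id zero add.
Proof. by elim/quotW=> x; rewrite !piE; apply: pi_eq => /=; ring. Qed.

Lemma addN : left_inverse zero opp add.
Proof. by elim/quotW=> x; rewrite !piE; apply: pi_eq => /=; ring. Qed.

HB.instance Definition _ := GRing.isZmodule.Build type addA addC add0 addN.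

Lemma mulA : associative mul.
Proof.
elim/quotW=> x; elim/quotW=> y; elim/quotW=> z.
by rewrite !piE; apply: pi_eq => /=; ring.
Qed.

Lemma mulC : commutative mul.
Proof.
by elim/quotW=> x; elim/quotW=> y; rewrite !piE; apply: pi_eq => /=; ring.
Qed.

Lemma mul1 : left_id one mul.
Proof. by elim/quotW=> x; rewrite !piE; apply: pi_eq => /=; ring. Qed.

Lemma mulDl : left_distributive mul add.
Proof.
elim/quotW=> x; elim/quotW=> y; elim/quotW=> z.
by rewrite !piE; apply: pi_eq => /=; ring.
Qed.

HB.instance Definition _ :=
  GRing.Zmodule_isComPzRing.Build type mulA mulC mul1 mulDl.

Definition ring : comPzRingType := type.

End Localization.
End Localization.

Definition localization (R : comPzRingType) (W : set R) : comPzRingType :=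
  Localization.ring W.

Section UnitDimension.
Variable R : comPzRingType.

Definition nonnilpotent_sums (V : set R) : set R :=
  [set x | ~ nilpotent x /\
     exists2 s : seq R, {in s, forall v, V v} & x = \sum_(v <- s) v].

Fixpoint udim_set (n : nat) : set R :=
  if n is m.+1 then nonnilpotent_sums (saturation (udim_set m)) else [set 1].

(* Meaningful when the nilradical of [R] is prime (see
   [udim_set_multiplicative]). *)
Definition udim : \bar int :=
  infimum +oo%E
    [set (n%:Z)%:E | n in [set n | unit_additive (localization (udim_set n))]].

Lemma udim_set_multiplicative n :
  nilradical_prime R -> multiplicative_set (udim_set n).
Proof.
move=> [nil1 nilM]; elim: n => [|n [IH1 IHM]] /=.
  by split=> // x y -> ->; rewrite /= mulr1.
split=> [|x y [nx [s sV xE]] [ny [t tV yE]]].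
  split=> //; exists [:: 1]; last by rewrite big_seq1.
  by move=> x; rewrite inE => /eqP ->; exists 1; rewrite mulr1.
split; first by case/nilM.
exists [seq a * b | a <- s, b <- t]; last first.
  by rewrite xE yE big_distrl big_allpairs_dep /=; apply: eq_bigr => a _; rewrite mulr_sumr.
move=> _ /allpairsP[[a b] /= [/sV[a' Wa] /tV[b' Wb] ->]].
by exists (a' * b'); rewrite mulrACA; exact: IHM.
Qed.

End UnitDimension.

(* Main.v *)
(* The lower bound for [dim S] comes from explicit chains: the extension of a
   chain of [D], followed by adding the indeterminates one at a time. For [D]
   Noetherian, Krull's principal ideal theorem shows that adjacent primes of [R]
   have adjacent extensions to [R[X]], so that [dim R[X] <= dim R + 1] for every
   Noetherian ring [R]; this is iterated along [D[X_1]...[X_n]], which maps onto [S].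
   Finally [udim S = udim D], since a divisor of a nonzero constant is constant.
   If the first [n] localizations [W_i^-1 D] are not unit-additive, each has a
   sum of units that is transcendental over the units of the previous one; by
   Zariski's lemma a prime avoiding [W_(i+1)] is properly contained in one
   avoiding [W_i], which gives a chain of length [n] in [D]. *)
Require Import Defs.
From HB Require Import structures.
From mathcomp Require Import all_boot all_order all_algebra.
From mathcomp Require Import generic_quotient ring_quotient fraction.
From mathcomp Require Import boolp classical_sets cardinality functions.
From mathcomp Require Import constructive_ereal.
From mathcomp Require Import finmap ring zify.
From mathcomp Require Import -(notations) monalg.

Set Implicit Arguments.
Unset Strict Implicit.
Unset Printing Implicit Defensive.

Import Order.TTheory GRing.Theory.
Local Open Scope classical_set_scope.
Local Open Scope ring_scope.
Local Open Scope quotient_scope.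

Lemma idealE (R : comNzRingType) (J : set R) :
  ideal J <-> J 0 /\ forall a x y, J x -> J y -> J (a * x + y).
Proof.
split=> [[J0 JD]|[J0 JD]].
  split=> [|a x y /mem_set Jx /mem_set Jy]; first exact: set_mem J0.
  exact: set_mem (JD a x y Jx Jy).
by split=> [|a x y /set_mem Jx /set_mem Jy]; apply: mem_set => //; apply: JD.
Qed.

Lemma prime_idealE (R : comNzRingType) (P : set R) :
  prime_ideal P <->
  [/\ ideal P, ~ P 1 & forall x y, P (x * y) -> P x \/ P y].
Proof.
split=> [[[P0 P1 PD] PM]|[/idealE[P0 PD] P1 PM]].
  split; last by move=> x y /mem_set/PM/orP[/set_mem|/set_mem]; [left|right].
    by apply/idealE; split=> [|a x y /mem_set Px /mem_set Py]; apply: set_mem => //;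
      apply: PD.
  by move=> /mem_set; apply/negP.
split; first split.
- exact: mem_set.
- by apply/negP => /set_mem.
- by move=> a x y /set_mem Px /set_mem Py; apply: mem_set; apply: PD.
- by move=> x y /set_mem/PM[]/mem_set ->; rewrite ?orbT.
Qed.

Section IdealTheory.
Variables (R : comNzRingType) (J : set R).
Hypothesis idJ : ideal J.

Lemma ideal0 : J 0. Proof. by case/idealE: idJ. Qed.

Lemma idealMD a x y : J x -> J y -> J (a * x + y).
Proof. by case/idealE: idJ => _; apply. Qed.

Lemma idealD x y : J x -> J y -> J (x + y).
Proof. by move=> Jx Jy; rewrite -[x]mul1r; exact: idealMD. Qed.

Lemma ideal_mull a x : J x -> J (a * x).
Proof. by move=> Jx; rewrite -[_ * _]addr0; apply: idealMD => //; exact: ideal0. Qed.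

Lemma ideal_mulr a x : J x -> J (x * a).
Proof. by rewrite mulrC; exact: ideal_mull. Qed.

Lemma idealN x : J x -> J (- x).
Proof. by rewrite -mulN1r; exact: ideal_mull. Qed.

Lemma idealB x y : J x -> J y -> J (x - y).
Proof. by move=> Jx /idealN; exact: idealD. Qed.

Lemma idealDr x y : J x -> J (x + y) -> J y.
Proof. by move=> Jx Jxy; rewrite -[y](addKr x); apply: idealD => //; exact: idealN. Qed.

Lemma ideal_sum (I : Type) (r : seq I) (Q : pred I) (F : I -> R) :
  (forall i, Q i -> J (F i)) -> J (\sum_(i <- r | Q i) F i).
Proof. by move=> JF; elim/big_ind: _ => //; [exact: ideal0|exact: idealD]. Qed.

End IdealTheory.

Section PrimeTheory.
Variables (R : comNzRingType) (P : set R).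
Hypothesis prP : prime_ideal P.

Lemma prime_is_ideal : ideal P. Proof. by case/prime_idealE: prP. Qed.

Lemma prime1 : ~ P 1. Proof. by case/prime_idealE: prP. Qed.

Lemma primeM x y : P (x * y) -> P x \/ P y.
Proof. by case/prime_idealE: prP => _ _; apply. Qed.

Lemma primeMl x y : ~ P x -> P (x * y) -> P y.
Proof. by move=> Px /primeM[]. Qed.

Lemma prime_nM x y : ~ P x -> ~ P y -> ~ P (x * y).
Proof. by move=> Px Py /primeM[]. Qed.

Lemma prime_nX x n : ~ P x -> ~ P (x ^+ n).
Proof.
move=> Px; elim: n => [|n IHn]; first by rewrite expr0; exact: prime1.
by rewrite exprS; exact: prime_nM.
Qed.

End PrimeTheory.

Lemma preimage_prime (A B : comNzRingType) (f : {rmorphism A -> B}) (Q : set B) :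
  prime_ideal Q -> prime_ideal (f @^-1` Q).
Proof.
move=> prQ; have idQ := prime_is_ideal prQ.
apply/prime_idealE; split=> [||x y]; rewrite /preimage /=.
- apply/idealE; split=> [|a x y]; first by rewrite /= rmorph0; exact: ideal0.
  by rewrite /= rmorphD rmorphM; exact: idealMD.
- by rewrite /= rmorph1; exact: prime1.
- by rewrite /= rmorphM; exact: primeM.
Qed.

Lemma zero_prime (A : idomainType) : prime_ideal [set x : A | x = 0].
Proof.
apply/prime_idealE; split=> /= [|/eqP|x y /eqP].
- by apply/idealE; split=> //= a x y -> ->; rewrite mulr0 addr0.
- by rewrite oner_eq0.
- by rewrite mulf_eq0 => /orP[]/eqP; [left|right].
Qed.

Section ResidueDomain.
Variables (R : comNzRingType) (I : prime_idealr R).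

Definition rdom : Type := {ideal_quot I}.

HB.instance Definition _ := GRing.ComNzRing.on rdom.

Definition rdom_unit : {pred rdom} := fun x => `[< exists y, y * x = 1 >].
Definition rdom_inv (x : rdom) : rdom :=
  if pselect (exists y, y * x = 1) is left e then projT1 (cid e) else x.

Lemma rdom_mulV : {in rdom_unit, left_inverse 1 rdom_inv *%R}.
Proof.
move=> x /asboolP xU; rewrite /rdom_inv; case: pselect => // e.
by case: cid.
Qed.

Lemma rdom_unitP (x y : rdom) : y * x = 1 -> rdom_unit x.
Proof. by move=> yx; apply/asboolP; exists y. Qed.

Lemma rdom_inv_out : {in [predC rdom_unit], rdom_inv =1 id}.
Proof. by move=> x /asboolP xU; rewrite /rdom_inv; case: pselect. Qed.

HB.instance Definition _ :=
  GRing.ComNzRing_hasMulInverse.Build rdom rdom_mulV rdom_unitP rdom_inv_out.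

HB.instance Definition _ := GRing.ComUnitRing_isIntegral.Build rdom
  (@Quotient.rquot_IdomainAxiom R I).

End ResidueDomain.

Lemma residue_field (R : comNzRingType) (P : set R) : prime_ideal P ->
  exists (F : fieldType) (h : {rmorphism R -> F}), forall x, P x <-> h x = 0.
Proof.
move=> prP; have [idP prMP] := prP.
pose mI := isIdealr.Build R (fun x => x \in P) idP.
pose mP := isPrimeIdealrClosed.Build R (fun x => x \in P) prMP.
pose I : prime_idealr R := HB.pack (fun x => x \in P) mI mP.
pose q : {rmorphism R -> rdom I} := (\pi_{ideal_quot I} : R -> {ideal_quot I}).
exists {fraction (rdom I)}, (@tofrac (rdom I) \o q) => x /=.
have qE : (q x == 0) = (x \in P).
  have := Quotient.idealrBE I x 0; rewrite subr0 => ->.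
  by rewrite -[0 in LHS](rmorph0 q).
split=> [Px|/eqP]; first by move/mem_set: Px; rewrite -qE => /eqP ->; rewrite rmorph0.
by rewrite tofrac_eq0 qE => /set_mem.
Qed.

(** * Chains of primes and Krull dimension *)

Section Chains.
Variable R : comNzRingType.

Fixpoint chain_to (n : nat) (Q : set R) : Prop :=
  prime_ideal Q /\ if n is m.+1 then exists2 Q', chain_to m Q' & Q' `<` Q else True.

Definition has_chain (n : nat) : Prop := exists Q, chain_to n Q.

Lemma chain_to_prime n Q : chain_to n Q -> prime_ideal Q.
Proof. by case: n => [|n] []. Qed.

Lemma chain_toS n Q Q' :
  chain_to n Q -> prime_ideal Q' -> Q `<` Q' -> chain_to n.+1 Q'.
Proof. by move=> cQ prQ' QQ'; split=> //; exists Q. Qed.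

Lemma chain_toW n Q : chain_to n.+1 Q -> chain_to n Q.
Proof.
elim: n Q => [|n IHn] Q /= [prQ [Q' cQ' QQ']]; first by [].
by split=> //; exists Q' => //; exact: IHn.
Qed.

Lemma has_chainW m n : (m <= n)%N -> has_chain n -> has_chain m.
Proof.
move=> /subnK <-; elim: (n - m)%N => // k IHk [Q].
by rewrite addSn => /chain_toW cQ; apply: IHk; exists Q.
Qed.

Lemma chain_toE n Q :
  chain_to n Q <-> exists P, @prime_chain R n P /\ P n = Q.
Proof.
elim: n Q => [|n IHn] Q.
  split=> [[prQ _]|[P [[prP _] <-]]]; last by split=> //; exact: prP.
  by exists (fun=> Q).
split=> [[prQ [Q' /IHn[P [[prP ltP] PQ']] QQ']]|[P [[prP ltP] <-]]].
  exists (fun i => if (i <= n)%N then P i else Q); split; last by rewrite ltnn.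
  split=> i le_in; first by case: leqP => // ?; exact: prP.
  rewrite ltnS in le_in; rewrite le_in.
  have [lt_in|?] := ltnP i n; first exact: ltP.
  have -> : i = n by lia.
  by rewrite PQ'.
split; first exact: prP.
exists (P n); last exact: ltP.
by apply/IHn; exists P; split=> //; split=> i ?; [apply: prP|apply: ltP]; lia.
Qed.

Lemma has_chainE n : has_chain n <-> exists P, @prime_chain R n P.
Proof.
split=> [[Q /chain_toE[P [cP _]]]|[P cP]]; first by exists P.
by exists (P n); apply/chain_toE; exists P.
Qed.

End Chains.

Lemma is_supremum (x0 x : \bar int) (A : set (\bar int)) :
  A !=set0 -> supremums A x -> supremum x0 A = x.
Proof.
move=> A0 Ax; rewrite /supremum; case: eqP => [A_eq|_].
  by case: A0 => a; rewrite A_eq.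
by case: xgetP => [y _ Ay|/(_ x)//]; exact: is_subset1_supremums Ay Ax.
Qed.

Lemma krull_dim_cases (R : comNzRingType) (Q : set R) : prime_ideal Q ->
  (exists n, [/\ krull_dim R = (n%:Z)%:E, has_chain R n &
                 forall m, has_chain R m -> (m <= n)%N]) \/
  (krull_dim R = +oo%E /\ forall n, has_chain R n).
Proof.
move=> prQ; have c0 : has_chain R 0 by exists Q.
rewrite /krull_dim.
have -> : [set n | exists P, @prime_chain R n P] = has_chain R.
  by apply/predeqP => n; split=> /has_chainE.
set A := image _ _.
have A0 : A !=set0 by exists (0%:Z)%:E; exists 0%N.
have [[N bN]|noN] := pselect (exists N, forall m, has_chain R m -> (m <= N)%N).
  left.
  have exP : exists m, `[< has_chain R m >] by exists 0%N; apply/asboolP.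
  have bP m : `[< has_chain R m >] -> (m <= N)%N by move/asboolP/bN.
  case: (ex_maxnP exP bP) => n /asboolP cn nmax.
  have nmax' m : has_chain R m -> (m <= n)%N by move=> cm; apply/nmax/asboolP.
  exists n; split=> //; apply: is_supremum => //; split=> [_ [m cm <-]|y].
    by rewrite lee_fin; have := nmax' _ cm; lia.
  by apply; exists n.
have call n : has_chain R n.
  apply: contrapT => ncn; apply: noN; exists n => m cm; rewrite leqNgt; apply/negP => lt_nm.
  by apply: ncn; apply: has_chainW cm; exact: ltnW.
right; split=> //; apply: is_supremum => //; split=> [_ [m cm <-]|y yub].
  by rewrite leey.
case: y yub => [z||] yub; rewrite ?leey //.
- have := yub _ (ex_intro2 _ _ `|z|.+1%N (call _) erefl).
  by rewrite lee_fin; lia.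
- by have := yub _ (ex_intro2 _ _ 0%N (call _) erefl).
Qed.

Lemma infimum_nat_le (A : set nat) n : A n ->
  (infimum +oo%E [set (m%:Z)%:E | m in A] <= (n%:Z)%:E)%E.
Proof.
move=> An; apply: le_infimum_Nmem; last by exists n.
have exA : exists m, `[< A m >] by exists n; apply/asboolP.
case: (ex_minnP exA) => m /asboolP Am mmin.
exists (m%:Z)%:E; split=> [_ [j Aj <-]|y]; last by apply; exists m.
by rewrite lee_fin; have := mmin j (introT (asboolP _) Aj); lia.
Qed.

Lemma ecard_cases (T : choiceType) :
  (exists s : seq T, [/\ uniq s, forall x, x \in s & ecard T = ((size s)%:Z)%:E]) \/
  (ecard T = +oo%E /\ forall n, exists s : seq T, uniq s /\ size s = n).
Proof.
rewrite /ecard; case: pselect => [finT|infT]; [left|right].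
  exists (fset_set [set: T]); split=> [|x|]; [exact: fset_uniq| |by []].
  by rewrite in_fset_set // in_setT.
split=> // n; have [B _ nB] := infinite_set_fset n infT.
exists (take n B); split; first by rewrite take_uniq ?fset_uniq.
by rewrite size_takel.
Qed.

(** * Noetherian rings *)

Section Noetherian.
Variable R : comNzRingType.
Implicit Types (J : set R) (s : seq R).

Definition ideal_gen s : set R :=
  [set x | exists a : nat -> R, x = \sum_(i < size s) a i * s`_i].

Lemma ideal_gen_nil x : ideal_gen [::] x <-> x = 0.
Proof. by split=> [[a ->]|->]; [rewrite big_ord0|exists (fun=> 0); rewrite big_ord0]. Qed.

Lemma ideal_gen_cons g s x :
  ideal_gen (g :: s) x <-> exists a y, ideal_gen s y /\ x = a * g + y.
Proof.
split=> [[a ->]|[a [_ [[b ->] ->]]]].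
  exists (a 0%N), (\sum_(i < size s) a i.+1 * s`_i); split; last by rewrite big_ord_recl.
  by exists (fun i => a i.+1).
by exists (fun i => if i is j.+1 then b j else a); rewrite big_ord_recl.
Qed.

Lemma ideal_genP s : ideal (ideal_gen s).
Proof.
apply/idealE; elim: s => [|g s [IH0 IHD]].
  by split=> [|a x y /ideal_gen_nil -> /ideal_gen_nil ->]; apply/ideal_gen_nil;
    rewrite ?mulr0 ?addr0.
split=> [|a x y /ideal_gen_cons[b [x' [gx' ->]]] /ideal_gen_cons[d [y' [gy' ->]]]].
  by apply/ideal_gen_cons; exists 0, 0; rewrite mul0r addr0.
apply/ideal_gen_cons; exists (a * b + d), (a * x' + y'); split; first exact: IHD.
by ring.
Qed.

Lemma mem_ideal_gen s x : x \in s -> ideal_gen s x.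
Proof.
elim: s => // g s IHs; rewrite inE => /orP[/eqP ->|/IHs gx]; apply/ideal_gen_cons.
  by exists 1, 0; rewrite mul1r addr0; split=> //; apply: ideal0; exact: ideal_genP.
by exists 0, x; rewrite mul0r add0r.
Qed.

Lemma ideal_gen_sub s J : ideal J -> {in s, forall x, J x} -> ideal_gen s `<=` J.
Proof.
move=> idJ sJ x [a ->]; apply: ideal_sum => // i _; apply: ideal_mull => //.
by apply: sJ; exact: mem_nth.
Qed.

Lemma ideal_bigcup (J : nat -> set R) : (forall n, ideal (J n)) ->
  (forall n, J n `<=` J n.+1) -> ideal [set x | exists n, J n x].
Proof.
move=> idJ incJ; have leJ m n : (m <= n)%N -> J m `<=` J n.
  by move=> /subnK <-; elim: (n - m)%N => //= k IHk x /IHk/incJ.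
apply/idealE; split=> [|a x y [m Jx] [n Jy]]; first by exists 0%N; exact: ideal0.
exists (maxn m n); apply: idealMD => //.
  by apply: leJ Jx; exact: leq_maxl.
by apply: leJ Jy; exact: leq_maxr.
Qed.

Hypothesis noethR : noetherian R.

Lemma noetherian_acc (J : nat -> set R) : (forall n, ideal (J n)) ->
  (forall n, J n `<=` J n.+1) -> exists N, forall n, J n `<=` J N.
Proof.
move=> idJ incJ; have leJ m n : (m <= n)%N -> J m `<=` J n.
  by move=> /subnK <-; elim: (n - m)%N => //= k IHk x /IHk/incJ.
have [s sE] := noethR (ideal_bigcup idJ incJ).
have : {in s, forall x, exists n, J n x}.
  by move=> x /mem_ideal_gen; rewrite /ideal_gen -sE.
move=> sJ; suff [N sN] : exists N, {in s, forall x, J N x}.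
  exists N => n x Jx; apply: (ideal_gen_sub (idJ N) sN).
  by rewrite /ideal_gen -sE; exists n.
elim: s sJ {sE} => [|g s IHs] sJ; first by exists 0%N.
have [|N sN] := IHs; first by move=> x xs; apply: sJ; rewrite inE xs orbT.
have [n gn] := sJ g (mem_head _ _).
exists (maxn n N) => x; rewrite inE => /orP[/eqP ->|/sN Jx].
  by apply: leJ gn; exact: leq_maxl.
by apply: leJ Jx; exact: leq_maxr.
Qed.

Lemma noetherian_max (F : set (set R)) : F `<=` [set J | ideal J] -> F !=set0 ->
  exists2 M, F M & forall J, F J -> M `<=` J -> J `<=` M.
Proof.
move=> Fid [J0 FJ0]; apply: contrapT => noM.
have step (J : {J | F J}) : exists J' : {J | F J}, sval J `<=` sval J' /\ ~ sval J' `<=` sval J.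
  case: J => J FJ /=; apply: contrapT => nJ; apply: noM; exists J => // J' FJ' JJ'.
  by apply: contrapT => nJ'; apply: nJ; exists (exist _ J' FJ').
have [f fP] := choice step.
pose J n := iter n f (exist _ J0 FJ0).
have [||N] := @noetherian_acc (fun n => sval (J n)).
- by move=> n; apply: Fid; exact: svalP.
- by move=> n; have [] := fP (J n).
by move=> /(_ N.+1); have [_] := fP (J N).
Qed.

End Noetherian.

Lemma noetherian_surj (A B : comNzRingType) (f : {rmorphism A -> B}) :
  (forall y, exists x, f x = y) -> noetherian A -> noetherian B.
Proof.
move=> fsurj noethA J idJ.
have idf : ideal (f @^-1` J).
  apply/idealE; split=> [|a x y]; first by rewrite /= rmorph0; exact: ideal0.
  by rewrite /= rmorphD rmorphM; exact: idealMD.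
have [s sE] := noethA _ idf; exists (map f s); rewrite -[RHS]/(ideal_gen _).
apply/seteqP; split=> [y Jy|]; last first.
  apply: ideal_gen_sub => // _ /mapP[x xs ->].
  by have : (f @^-1` J) x by rewrite sE; exact: mem_ideal_gen.
have [x fx] := fsurj y; have : (f @^-1` J) x by rewrite /= fx.
rewrite sE -fx => -[a ->]; rewrite rmorph_sum; apply: ideal_sum => [|i _].
  exact: ideal_genP.
rewrite rmorphM; apply: ideal_mull; first exact: ideal_genP.
by apply: mem_ideal_gen; apply: map_f; exact: mem_nth.
Qed.

Lemma noetherian_field (k : fieldType) : noetherian k.
Proof.
move=> J idJ; have [[x [Jx x0]]|noJ] := pselect (exists x, J x /\ x != 0).
  exists [:: 1]; apply/seteqP; split=> y _; first by exists (fun=> y); rewrite big_ord1 mulr1.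
  by rewrite -[y](divfK x0); exact: ideal_mull.
exists [::]; rewrite -[RHS]/(ideal_gen _); apply/predeqP => x.
rewrite ideal_gen_nil; split=> [Jx|->]; last exact: ideal0.
by apply/eqP; apply: contrapT => /negP x0; apply: noJ; exists x.
Qed.

Lemma Hilbert_basis (R : comNzRingType) : noetherian R -> noetherian {poly R}.
Proof.
move=> noethR J idJ.
pose L n : set R := [set c | exists p : {poly R}, [/\ J p, (size p <= n.+1)%N & p`_n = c]].
have idL n : ideal (L n).
  apply/idealE; split=> [|a _ _ [p [Jp sp <-]] [q [Jq sq <-]]].
    by exists 0; rewrite size_poly0 coef0; split=> //; exact: ideal0.
  exists (a%:P * p + q); split; first exact: idealMD.
    rewrite (leq_trans (size_polyD _ _)) // geq_max sq mul_polyC.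
    by rewrite (leq_trans (size_scale_leq _ _)).
  by rewrite coefD coefCM.
have incL n : L n `<=` L n.+1.
  move=> _ [p [Jp sp <-]]; exists (p * 'X); split; first exact: ideal_mulr.
    have [->|p0] := eqVneq p 0; first by rewrite mul0r size_poly0.
    by rewrite size_mulX.
  by rewrite coefMX.
have [N LN] := noetherian_acc noethR idL incL.
have lift n : exists G : seq {poly R}, {in G, forall p, J p} /\
    forall c, L n c -> exists q, [/\ ideal_gen G q, (size q <= n.+1)%N & q`_n = c].
  have [s sE] := noethR _ (idL n); rewrite -[RHS]/(ideal_gen s) in sE.
  have sL : {in s, forall x, L n x} by move=> x; rewrite sE; exact: mem_ideal_gen.
  suff [G [GJ GP]] : exists G : seq {poly R}, {in G, forall p, J p} /\
      forall c, ideal_gen s c -> exists q, [/\ ideal_gen G q, (size q <= n.+1)%N & q`_n = c].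
    by exists G; split=> // c; rewrite sE; exact: GP.
  elim: s sL {sE} => [|g s IHs] sL.
    exists [::]; split=> // c /ideal_gen_nil ->; exists 0; rewrite size_poly0 coef0.
    by split=> //; exact: ideal0 (ideal_genP _).
  have [|G [GJ GP]] := IHs; first by move=> x xs; apply: sL; rewrite inE xs orbT.
  have [p [Jp sp pn]] := sL g (mem_head _ _).
  exists (p :: G); split=> [q|c /ideal_gen_cons[a [d [/GP[q [Gq sq qn]] ->]]]].
    by rewrite inE => /orP[/eqP ->|/GJ].
  exists (a%:P * p + q); split; first by apply/ideal_gen_cons; exists a%:P, q.
    rewrite (leq_trans (size_polyD _ _)) // geq_max sq mul_polyC.
    by rewrite (leq_trans (size_scale_leq _ _)).
  by rewrite coefD coefCM pn qn.
have [G GP] := choice lift.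
pose H := flatten [seq G i | i <- iota 0 N.+1].
exists H; rewrite -[RHS]/(ideal_gen _); apply/seteqP; split; last first.
  apply: ideal_gen_sub => // p /flatten_mapP[i _]; have [GJ _] := GP i; exact: GJ.
have idH := ideal_genP H.
move=> p; have [n] := ubnP (size p); elim: n p => // n IHn p; rewrite ltnS => sp Jp.
case: n => [|n] in IHn sp *.
  by move: sp; rewrite leqn0 size_poly_eq0 => /eqP ->; exact: ideal0.
pose m := minn n N.
have [q [Gq sq qn]] : exists q, [/\ ideal_gen (G m) q, (size q <= m.+1)%N & q`_m = p`_n].
  have [_] := GP m; apply; have : L n p`_n by exists p.
  rewrite /m; case: leqP => // _; exact: LN.
have mN : m \in iota 0 N.+1 by rewrite mem_iota add0n ltnS geq_minr.
have Hq : ideal_gen H q.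
  move: Gq; apply: ideal_gen_sub => // x xG; apply: mem_ideal_gen.
  by apply/flatten_mapP; exists m.
have Jq : J q.
  by move: Gq; apply: ideal_gen_sub => // x; have [GJ _] := GP m; exact: GJ.
rewrite -[p](subrK ('X^(n - m) * q)); apply: (idealD idH); last exact: ideal_mull.
apply: IHn; last by apply: (idealB idJ) => //; exact: ideal_mull.
have mn : (m <= n)%N by exact: geq_minl.
rewrite ltnS; apply/leq_sizeP => j; rewrite leq_eqVlt => /orP[/eqP <-|nj].
  by rewrite coefB coefXnM ltnNge leq_subr /= subKn // qn subrr.
rewrite coefB coefXnM [p`_j]nth_default ?(leq_trans sp) // ifF; last by lia.
by rewrite nth_default ?subr0 //; apply: leq_trans sq _; lia.
Qed.

(** * Krull's principal ideal theorem *)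

Section SaturatedIdeals.
Variables (R : comNzRingType) (P : set R).
Hypothesis prP : prime_ideal P.
Let idP := prime_is_ideal prP.

(* The ideals of [R] contracted from the localization of [R] at [P]. *)
Definition sat_ideal (J : set R) : Prop :=
  ideal J /\ forall s x, ~ P s -> J (s * x) -> J x.

Definition saturate (J : set R) : set R := [set x | exists2 s, ~ P s & J (s * x)].

Definition ideal_add (J : set R) (a : R) : set R :=
  [set x | exists y r, J y /\ x = y + r * a].

Lemma ideal_addP J a : ideal J -> ideal (ideal_add J a).
Proof.
move=> idJ; apply/idealE; split.
  by exists 0, 0; split; [exact: ideal0|ring].
move=> b _ _ [x [r [Jx ->]]] [y [t [Jy ->]]].
by exists (b * x + y), (b * r + t); split; [exact: idealMD|ring].
Qed.

Lemma ideal_add_sub J a : J `<=` ideal_add J a.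
Proof. by move=> x Jx; exists x, 0; split=> //; ring. Qed.

Lemma ideal_add_gen J a : ideal J -> ideal_add J a a.
Proof. by move=> idJ; exists 0, 1; split; [exact: ideal0|ring]. Qed.

Lemma ideal_addS J J' a : J `<=` J' -> ideal_add J a `<=` ideal_add J' a.
Proof. by move=> JJ' _ [y [r [/JJ' Jy ->]]]; exists y, r. Qed.

Lemma saturate_sub J : J `<=` saturate J.
Proof. by move=> x Jx; exists 1; rewrite ?mul1r //; exact: prime1. Qed.

Lemma saturateS J J' : J `<=` J' -> saturate J `<=` saturate J'.
Proof. by move=> JJ' x [s Ps /JJ']; exists s. Qed.

Lemma saturateP J : ideal J -> sat_ideal (saturate J).
Proof.
move=> idJ; split=> [|s x Ps [t Pt Jx]]; last first.
  by exists (t * s); [exact: prime_nM|rewrite -mulrA].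
apply/idealE; split=> [|a x y [s Ps Jx] [t Pt Jy]].
  by apply: saturate_sub; exact: ideal0.
exists (s * t); first exact: prime_nM.
have -> : s * t * (a * x + y) = (t * a) * (s * x) + s * (t * y) by ring.
by apply: idealMD => //; exact: ideal_mull.
Qed.

Lemma colon_sat_ideal J a : sat_ideal J -> sat_ideal [set x | J (x * a)].
Proof.
move=> [idJ satJ]; split=> [|s x Ps /=]; last by rewrite -mulrA; exact: satJ.
apply/idealE; split=> [|b x y /= Jx Jy]; first by rewrite /= mul0r; exact: ideal0.
by rewrite mulrDl -mulrA; exact: idealMD.
Qed.

Lemma sat_ideal_proper J : sat_ideal J -> ~ J 1 -> J `<=` P.
Proof.
move=> [idJ satJ] J1 x Jx; apply: contrapT => Px; apply: J1; apply: (satJ x) => //.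
by rewrite mulr1.
Qed.

Section Descending.
Variables (N0 : set R) (c : R).
Hypotheses (noethR : noetherian R)
  (minP : forall Q, prime_ideal Q -> N0 `<=` Q -> Q `<=` P -> Q c -> P `<=` Q).

(* The local ring of [P] modulo [N0] and [c] is Artinian; this is proved by
   Noetherian induction, an ideal [J] that is not prime being replaced by
   [J + (a)] and [J : a] with [a, b] outside [J] and [a * b] in [J]. *)
Lemma sat_ideal_dcc (J : set R) (I : nat -> set R) :
  sat_ideal J -> N0 `<=` J -> J c ->
  (forall n, sat_ideal (I n)) -> (forall n, J `<=` I n) ->
  (forall n, I n.+1 `<=` I n) ->
  exists N, forall n, (N <= n)%N -> I N `<=` I n.
Proof.
move=> sJ N0J Jc.
pose dcc J := forall I : nat -> set R,
  (forall n, sat_ideal (I n)) -> (forall n, J `<=` I n) ->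
  (forall n, I n.+1 `<=` I n) ->
  exists N, forall n, (N <= n)%N -> I N `<=` I n.
suff dccJ : dcc J by exact: dccJ.
clear I.
pose bad := [set J | [/\ sat_ideal J, N0 `<=` J, J c & ~ dcc J]].
apply: contrapT => ndcc; have badJ : bad J by [].
have [||M [sM N0M Mc nM] Mmax] := @noetherian_max R noethR bad.
- by move=> M [[]].
- by exists J.
clear J sJ N0J Jc ndcc badJ.
have good J : sat_ideal J -> M `<=` J -> ~ J `<=` M -> dcc J.
  move=> sJ MJ nJM; apply: contrapT => nJ; apply: nJM; apply: Mmax => //.
  by split=> //; [exact: subset_trans MJ|exact: MJ].
have [idM satM] := sM.
apply: nM => I sI MI decI.
have leI m n : (m <= n)%N -> I n `<=` I m.
  by move=> /subnK <-; elim: (n - m)%N => //= k IHk x /decI/IHk.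
have [M1|M1] := pselect (M 1).
  by exists 0%N => n _ x _; rewrite -[x]mulr1; apply: ideal_mull; [case: (sI n)|exact: MI].
have MP : M `<=` P by exact: sat_ideal_proper.
have [prM|nprM] := pselect (prime_ideal M).
  have PM : P `<=` M by exact: minP.
  have [[N I1]|noI1] := pselect (exists N, ~ I N 1).
    exists N => n _; apply: (subset_trans (sat_ideal_proper (sI N) I1)).
    exact: subset_trans (MI n).
  exists 0%N => n _ x _; rewrite -[x]mulr1; apply: ideal_mull; first by case: (sI n).
  by apply: contrapT => I1; apply: noI1; exists n.
have [a [b [Mab Ma Mb]]] : exists a b, [/\ M (a * b), ~ M a & ~ M b].
  apply: contrapT => nab; apply: nprM; apply/prime_idealE; split=> // a b Mab.
  have [Ma|Ma] := pselect (M a); [by left|right].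
  by apply: contrapT => Mb; apply: nab; exists a, b.
have idI n : ideal (I n) by case: (sI n).
have [||||||N1 I1P] := good (saturate (ideal_add M a)) _ _ _
    (fun n => saturate (ideal_add (I n) a)).
- by apply: saturateP; exact: ideal_addP.
- by apply: subset_trans (@ideal_add_sub M a) _; exact: saturate_sub.
- by move=> sub; apply: Ma; apply: sub; apply: saturate_sub; exact: ideal_add_gen.
- by move=> n; apply: saturateP; exact: ideal_addP.
- by move=> n; apply: saturateS; apply: ideal_addS.
- by move=> n; apply: saturateS; apply: ideal_addS.
have [||||||N2 I2P] := good [set x | M (x * a)] _ _ _ (fun n => [set x | I n (x * a)]).
- exact: colon_sat_ideal.
- by move=> x Mx; exact: ideal_mulr.
- by move=> /(_ b); rewrite /= mulrC; move=> /(_ Mab).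
- by move=> n; exact: colon_sat_ideal.
- by move=> n x; exact: MI.
- by move=> n x; exact: decI.
exists (maxn N1 N2) => n le_n x Ix.
have [le1 le2] : (N1 <= n)%N /\ (N2 <= n)%N by lia.
have [s Ps [y [r [Iy sx]]]] : saturate (ideal_add (I n) a) x.
  apply: I1P => //; apply: saturate_sub; apply: ideal_add_sub.
  by apply: leI Ix; exact: leq_maxl.
case: (sI n) => _; apply; first exact: Ps.
rewrite sx; apply: idealD => //; apply: (I2P n le2); rewrite /=.
have -> : r * a = s * x - y by rewrite sx; ring.
apply: idealB => //; last by apply: leI Iy.
by apply: ideal_mull => //; apply: leI Ix; exact: leq_maxr.
Qed.

End Descending.

Lemma local_Nakayama (c : R) (gs : seq R) (M' : set R) : P c -> sat_ideal M' ->
  (forall x, ideal_gen gs x ->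
     exists s x' r, [/\ ~ P s, M' x', ideal_gen gs r & s * x = x' + r * c]) ->
  ideal_gen gs `<=` M'.
Proof.
move=> Pc [idM' satM'] MP; set M := ideal_gen gs in MP *.
have idM : ideal M by exact: ideal_genP.
suff : forall l, {in l, forall g, M g} ->
    (forall x, M x -> exists s x' z,
       [/\ ~ P s, M' x', ideal_gen l z & s * x = x' + z]) -> M `<=` M'.
  apply=> [g|x Mx]; first exact: mem_ideal_gen.
  by exists 1, 0, x; split=> //; [exact: prime1|exact: ideal0|ring].
elim=> [|g l IHl] lM Ml.
  move=> x /Ml[s [x' [z [Ps M'x' /ideal_gen_nil -> sx]]]].
  by apply: (satM' s) => //; rewrite sx addr0.
apply: IHl => [h hl|x Mx]; first by apply: lM; rewrite inE hl orbT.
have idl := ideal_genP l.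
have [u [w [z [Pu M'w lz ug]]]] : exists u w z,
    [/\ ~ P u, M' w, ideal_gen l z & u * g = w + z].
  have [s [x' [r [Ps M'x' Mr sg]]]] := MP g (lM g (mem_head _ _)).
  have [t [x'' [_ [Pt M'x'' /ideal_gen_cons[a [z [lz ->]]] tr]]]] := Ml r Mr.
  exists (t * s - c * a), (t * x' + c * x''), (c * z); split.
  - by move=> /(idealD idP (ideal_mulr idP a Pc)); rewrite addrC subrK; exact: prime_nM.
  - by apply: idealD => //; exact: ideal_mull.
  - exact: ideal_mull.
  - have -> : (t * s - c * a) * g = t * (s * g) - c * a * g by ring.
    by rewrite sg mulrDr; have -> : t * (r * c) = t * r * c by [ring]; rewrite tr; ring.
have [s [x' [_ [Ps M'x' /ideal_gen_cons[a [z' [lz' ->]]] sx]]]] := Ml x Mx.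
exists (u * s), (u * x' + a * w), (a * z + u * z'); split.
- exact: prime_nM.
- by apply: idealD => //; exact: ideal_mull.
- by apply: idealD => //; exact: ideal_mull.
- have -> : u * s * x = u * (s * x) by ring.
  rewrite sx; transitivity (u * x' + a * (u * g) + u * z'); first by ring.
  by rewrite ug; ring.
Qed.

End SaturatedIdeals.

(* Krull's principal ideal theorem in [R / N0]. The symbolic powers of [N1] are
   replaced by the contractions [K n] of the ideals generated by [y ^+ n] in the
   local ring of [N1], for a fixed [y] in [N1] but not in [N0]. *)
Lemma principal_ideal_theorem (R : comNzRingType) (N0 N1 N2 : set R) (c : R) :
  noetherian R -> prime_ideal N0 -> prime_ideal N1 -> prime_ideal N2 ->
  N0 `<` N1 -> N1 `<` N2 -> N2 c ->
  ~ (forall Q, prime_ideal Q -> N0 `<=` Q -> Q `<=` N2 -> Q c -> N2 `<=` Q).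
Proof.
move=> noethR pr0 pr1 pr2 [N01 nN10] [N12 nN21] N2c minN2.
have [id0 id1] := (prime_is_ideal pr0, prime_is_ideal pr1).
have N1c : ~ N1 c by move=> N1c; apply: nN21; apply: minN2.
have [y [N1y N0y]] : exists y, N1 y /\ ~ N0 y.
  by apply: contrapT => noy; apply: nN10 => y N1y; apply: contrapT => N0y; apply: noy; exists y.
pose K n : set R := [set x | exists2 s, ~ N1 s & exists r, N0 (s * x - r * y ^+ n)].
have idK n : ideal (K n).
  apply/idealE; split=> [|a x z [s Ns [r Nx]] [t Nt [q Nz]]].
    by exists 1; [exact: prime1|exists 0; rewrite mulr0 mul0r subrr; exact: ideal0].
  exists (s * t); first exact: prime_nM.
  exists (t * a * r + s * q).
  have -> : s * t * (a * x + z) - (t * a * r + s * q) * y ^+ n =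
    (t * a) * (s * x - r * y ^+ n) + s * (t * z - q * y ^+ n) by ring.
  by apply: idealMD => //; exact: ideal_mull.
have satK1 n s x : ~ N1 s -> K n (s * x) -> K n x.
  move=> Ns [t Nt [r Nr]]; exists (t * s); first exact: prime_nM.
  by exists r; rewrite -mulrA.
have satK n : sat_ideal N2 (K n).
  by split=> // s x N2s; apply: satK1 => /N12.
have decK n : K n.+1 `<=` K n.
  by move=> x [s Ns [r Nr]]; exists s => //; exists (r * y); rewrite -mulrA -exprS.
have N0K n : N0 `<=` K n.
  move=> x Nx; exists 1; first exact: prime1.
  by exists 0; rewrite mul1r mul0r subr0.
pose sat J := saturate N2 (ideal_add J c).
have [||||||N IN] := @sat_ideal_dcc R N2 pr2 N0 c noethR minN2 (sat N0) (fun n => sat (K n)).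
- by apply: saturateP => //; exact: ideal_addP.
- by apply: subset_trans (@ideal_add_sub R N0 c) _; exact: saturate_sub.
- by apply: saturate_sub => //; exact: ideal_add_gen.
- by move=> n; apply: saturateP => //; exact: ideal_addP.
- by move=> n; apply: saturateS; apply: ideal_addS.
- by move=> n; apply: saturateS; apply: ideal_addS.
have [gs gsE] := noethR _ (idK N); rewrite -[RHS]/(ideal_gen gs) in gsE.
have KN : K N `<=` K N.+1.
  rewrite gsE; apply: (local_Nakayama pr2 N2c) => // x; rewrite -gsE => Kx.
  have [s Ns [x' [r [Kx' sx]]]] : sat (K N.+1) x.
    by apply: IN => //; apply: saturate_sub => //; exact: ideal_add_sub.
  exists s, x', r; split=> //; apply: (satK1 N c) => //.
  have -> : c * r = s * x - x' by rewrite sx; ring.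
  by apply: idealB => //; [exact: ideal_mull|exact: decK].
have [|s N1s [r]] := KN (y ^+ N).
  by exists 1; [exact: prime1|exists 1; rewrite subrr; exact: ideal0].
have -> : s * y ^+ N - r * y ^+ N.+1 = y ^+ N * (s - r * y) by rewrite exprS; ring.
move=> /(primeMl pr0 (prime_nX pr0 N0y)) /N01 N1sry; apply: N1s.
by rewrite -[s](subrK (r * y)); apply: idealD => //; exact: ideal_mull.
Qed.

(** * Primes of polynomial rings in one variable *)

Lemma integral_sum (R K : comNzRingType) (f : {rmorphism R -> K})
  (I : Type) (r : seq I) (Q : pred I) (F : I -> K) :
  (forall i, Q i -> integralOver f (F i)) -> integralOver f (\sum_(i <- r | Q i) F i).
Proof. by move=> intF; elim/big_ind: _ => //; [exact: integral0|exact: integral_add]. Qed.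

Lemma integral_exp (R K : comNzRingType) (f : {rmorphism R -> K}) x n :
  integralOver f x -> integralOver f (x ^+ n).
Proof.
move=> intx; elim: n => [|n IHn]; first by rewrite expr0; exact: integral1.
by rewrite exprS; exact: integral_mul.
Qed.

Lemma integral_clear (R : comNzRingType) (K : fieldType) (f : {rmorphism R -> K})
  (u : K) (p : {poly R}) :
  map_poly f p != 0 -> root (map_poly f p) u ->
  exists2 e, f e != 0 & forall (q : {poly R}) n, (size q <= n)%N ->
    integralOver f (f e ^+ n * (map_poly f q).[u]).
Proof.
set g := map_poly f p => g0 gu.
pose m := (size g).-1; pose e := p`_m.
have sg : size g = m.+1 by rewrite /m prednK // size_poly_gt0.
have feE : f e = lead_coef g by rewrite lead_coefE /g coef_map.
have fe0 : f e != 0 by rewrite feE lead_coef_eq0.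
have m0 : (0 < m)%N.
  rewrite lt0n; apply/eqP => m0.
  have gC : g = (f e)%:P.
    by rewrite [LHS]size1_polyC ?sg ?m0 // feE lead_coefE -/m m0.
  by move: gu; rewrite gC rootC; apply/negP.
have int_eu : integralOver f (f e * u).
  exists ('X^m + \poly_(i < m) (p`_i * e ^+ (m.-1 - i))).
    by rewrite monicE lead_coefDl ?lead_coefXn // size_polyXn ltnS size_poly.
  have gE : g.[u] = f e * u ^+ m + \sum_(i < m) f p`_i * u ^+ i.
    rewrite horner_coef sg big_ord_recr /= addrC coef_map; congr (_ + _).
    by apply: eq_bigr => i _; rewrite coef_map.
  rewrite rmorphD /= map_polyXn /root hornerD hornerXn.
  rewrite (@horner_coef_wide _ m); last exact: (leq_trans (size_poly _ _) (size_poly _ _)).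
  have -> : \sum_(i < m) (map_poly f (\poly_(i0 < m) (p`_i0 * e ^+ (m.-1 - i0))))`_i *
      (f e * u) ^+ i = f e ^+ m.-1 * \sum_(i < m) f p`_i * u ^+ i.
    rewrite mulr_sumr; apply: eq_bigr => i _; rewrite coef_map coef_poly ltn_ord /=.
    rewrite rmorphM rmorphXn exprMn.
    have -> : f e ^+ m.-1 = f e ^+ (m.-1 - i) * f e ^+ i.
      by rewrite -exprD subnK //; have := ltn_ord i; lia.
    by ring.
  rewrite exprMn.
  have -> : f e ^+ m = f e ^+ m.-1 * f e by rewrite -exprSr prednK.
  by rewrite -mulrA -mulrDr -gE (eqP gu) mulr0.
exists e => // q n le_qn.
rewrite horner_coef mulr_sumr; apply: integral_sum => i _.
have le_in : (i <= n)%N.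
  have := leq_trans (leq_trans (ltn_ord i) (size_poly _ _)) le_qn; exact: ltnW.
have -> : f e ^+ n * ((map_poly f q)`_i * u ^+ i) =
    f (q`_i * e ^+ (n - i)) * (f e * u) ^+ i.
  rewrite coef_map rmorphM rmorphXn exprMn -[in LHS](subnK le_in) exprD; ring.
by apply: integral_mul; [exact: integral_id|exact: integral_exp].
Qed.

Section PolynomialPrimes.
Variable R : comNzRingType.
Implicit Types (P : set R) (Q : set {poly R}).

Definition poly_ext P : set {poly R} := [set p | forall i, P p`_i].
Definition poly_contract Q : set R := [set a | Q a%:P].

Lemma poly_ext_prime P : prime_ideal P -> prime_ideal (poly_ext P).
Proof.
move=> /residue_field[F [h hP]].
suff -> : poly_ext P = map_poly h @^-1` [set x | x = 0].
  by apply: preimage_prime; exact: zero_prime.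
apply/predeqP => p; split=> [Pp|hp i].
  by apply/polyP => i; rewrite coef_map coef0; exact/hP.
by apply/hP; rewrite -coef_map (hp : map_poly h p = 0) coef0.
Qed.

Lemma poly_contract_prime Q : prime_ideal Q -> prime_ideal (poly_contract Q).
Proof. exact: (@preimage_prime _ _ (@polyC R)). Qed.

Lemma poly_ext_contract Q : ideal Q -> poly_ext (poly_contract Q) `<=` Q.
Proof.
move=> idQ p Qp; rewrite -[p]coefK poly_def; apply: ideal_sum => // i _.
by rewrite -mul_polyC; apply: ideal_mulr => //; exact: Qp.
Qed.

Lemma poly_extS P P' : P `<=` P' -> poly_ext P `<=` poly_ext P'.
Proof. by move=> PP' p Pp i; exact: PP'. Qed.

(* If [Q] is larger than the extension of its contraction [P], the image of ['X]
   in the residue field of [Q] is algebraic over that of [P], so an element of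
   [Q' \ Q] has an equation over [R] whose constant term is not in [P]. *)
Lemma poly_contract_inj Q Q' : prime_ideal Q -> prime_ideal Q' -> Q `<=` Q' ->
  ~ Q `<=` poly_ext (poly_contract Q) -> poly_contract Q' `<=` poly_contract Q ->
  Q' `<=` Q.
Proof.
move=> prQ prQ' QQ' nQ cQ' g Q'g; apply: contrapT => nQg.
have idQ' := prime_is_ideal prQ'.
have [F [h hQ]] := residue_field prQ.
have [p [Qp [i nQpi]]] : exists p, Q p /\ exists i, ~ Q (p`_i)%:P.
  apply: contrapT => nop; apply: nQ => p Qp i; apply: contrapT => nQpi.
  by apply: nop; exists p; split=> //; exists i.
pose f : {rmorphism R -> F} := h \o polyC.
have hE q : h q = (map_poly f q).[h 'X].
  rewrite -[in LHS](coefK q) poly_def rmorph_sum /= (horner_coef_wide _ (size_poly _ _)).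
  by apply: eq_bigr => j _; rewrite coef_map -mul_polyC rmorphM rmorphXn.
have [||e fe0 int_e] := @integral_clear _ _ f (h 'X) p.
- apply/eqP => p0; apply: nQpi; apply/hQ.
  by rewrite -[LHS]/(f _) -coef_map p0 coef0.
- by rewrite /root -hE; apply/eqP/hQ.
have [r mon_r] := int_e g _ (leqnn _); rewrite -hE.
set n := size g; rewrite -rmorphXn -[f (e ^+ n)]/(h (e ^+ n)%:P) -rmorphM.
set y := _ * g => root_r.
have Q'y : Q' y by exact: ideal_mull.
have nQy : ~ Q y.
  by apply: prime_nM => // /hQ /eqP; rewrite -[h _]/(f _) rmorphXn expf_eq0 (negbTE fe0) andbF.
have nz : exists j, h (r`_j)%:P != 0.
  exists (size r).-1; rewrite -lead_coefE (monicP mon_r) rmorph1; exact: oner_neq0.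
case: (ex_minnP nz) => j hj jmin.
pose z := \sum_(i < size r) if (j <= i)%N then (r`_i)%:P * y ^+ (i - j) else 0.
have Qz : Q (y ^+ j * z).
  apply/hQ; move/rootP: root_r => <-.
  rewrite (horner_coef_wide _ (size_poly _ _)) rmorphM rmorph_sum mulr_sumr.
  apply: eq_bigr => k _; rewrite coef_map; case: leqP => [le_jk|lt_kj].
    by rewrite rmorphM mulrCA -rmorphM -exprD subnKC // rmorphXn.
  rewrite rmorph0 mulr0; apply/esym/eqP; rewrite mulf_eq0 -[_ == 0]negbK.
  by rewrite (contra (jmin k)) // -ltnNge.
have {}Qz : Q z by exact: primeMl (prime_nX prQ (n := j) nQy) Qz.
have jr : (j < size r)%N.
  by rewrite ltnNge; apply: contra hj => /(nth_default 0) ->; rewrite rmorph0.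
suff : Q (r`_j)%:P by move/hQ => hj0; move: hj; rewrite hj0 eqxx.
apply: cQ'; rewrite /poly_contract /=.
have := QQ' _ Qz; rewrite /z (bigD1 (Ordinal jr)) //= leqnn subnn expr0 mulr1.
rewrite addrC; apply: idealDr => //; apply: ideal_sum => // k kj.
case: leqP => [le_jk|_]; last exact: ideal0.
apply: ideal_mull => //; have /subnK <- : (0 < k - j)%N.
  by rewrite subn_gt0 ltn_neqAle le_jk andbT eq_sym.
by rewrite addn1 exprS; exact: ideal_mulr.
Qed.

Hypothesis noethR : noetherian R.

(* [R] is a strong S-ring: by the principal ideal theorem in [{poly R}],
   adjacent primes of [R] have adjacent extensions. *)
Lemma prime_between P P' Q : prime_ideal P -> prime_ideal P' -> P `<` P' ->
  prime_ideal Q -> poly_ext P `<` Q -> Q `<` poly_ext P' ->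
  exists P'', [/\ prime_ideal P'', P `<` P'' & P'' `<` P'].
Proof.
move=> prP prP' [PP' nP'P] prQ PQ QP'; apply: contrapT => nob.
have [c [P'c nPc]] : exists c, P' c /\ ~ P c.
  by apply: contrapT => noc; apply: nP'P => c P'c; apply: contrapT => Pc; apply: noc; exists c.
have id0 J : prime_ideal J -> J 0 by move=> prJ; apply: ideal0; exact: prime_is_ideal.
have extC J a : prime_ideal J -> J a -> poly_ext J a%:P.
  by move=> prJ Ja [|i]; rewrite coefC //=; exact: id0.
apply: (principal_ideal_theorem (Hilbert_basis noethR)
  (poly_ext_prime prP) prQ (poly_ext_prime prP') PQ QP' (extC _ _ prP' P'c)).
move=> Q0 prQ0 PQ0 Q0P' Q0c.
have pr0 := poly_contract_prime prQ0.
apply: (subset_trans (B := poly_ext (poly_contract Q0))); last first.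
  by apply: poly_ext_contract; exact: prime_is_ideal.
apply: poly_extS; apply: contrapT => nP'0; apply: nob; exists (poly_contract Q0).
split=> //; split=> //.
- by move=> a Pa; apply: PQ0; exact: extC.
- by move=> sub; apply: nPc; exact: sub.
- by move=> a Qa; have := Q0P' _ Qa 0%N; rewrite coefC.
Qed.

Lemma chain_to_contract m Q : chain_to m Q ->
  chain_to m.-1 (poly_contract Q) /\
  (Q `<=` poly_ext (poly_contract Q) -> chain_to m (poly_contract Q)).
Proof.
elim: m Q => [|m IHm] Q cQ; have prP := poly_contract_prime (chain_to_prime cQ).
  by split.
have prQ := chain_to_prime cQ.
case: cQ => _ [Q' cQ' [Q'Q nQQ']].
have prQ' := chain_to_prime cQ'.
have [cP' cP'ext] := IHm _ cQ'.
have prP' := chain_to_prime cP'.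
set P := poly_contract Q in prP *; set P' := poly_contract Q' in cP' cP'ext prP' *.
have P'P : P' `<=` P by move=> a; exact: Q'Q.
have chainS k P1 P2 : chain_to k.-1 P1 -> prime_ideal P2 -> P1 `<` P2 -> chain_to k P2.
  by case: k => [|k] // cP1 prP2; exact: chain_toS.
split=> [/=|QP].
  have [PP'|nPP'] := pselect (P `<=` P'); last exact: chainS cP' _ _.
  have -> : P = P' by exact/seteqP.
  by apply: cP'ext; apply: contrapT => nQ'; apply: nQQ'; exact: poly_contract_inj nQ' PP'.
have ltP : P' `<` P.
  split=> // PP'; apply: nQQ'; apply: subset_trans QP _.
  by apply: subset_trans (poly_extS PP') _; apply: poly_ext_contract; exact: prime_is_ideal.
have [Q'ext|nQ'ext] := pselect (Q' `<=` poly_ext P').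
  exact: chain_toS (cP'ext Q'ext) prP ltP.
have [||P'' [prP'' ltP' ltP'']] := prime_between prP' prP ltP prQ'.
- by split=> //; apply: poly_ext_contract; exact: prime_is_ideal.
- split; first exact: subset_trans QP.
  move=> sub; apply: nQQ'; apply: subset_trans sub.
  by apply: subset_trans QP _.
by apply: chain_toS ltP'' => //; exact: chainS cP' _ _.
Qed.

Lemma has_chain_poly m : has_chain {poly R} m -> has_chain R m.-1.
Proof. by move=> [Q /chain_to_contract[cP _]]; exists (poly_contract Q). Qed.

End PolynomialPrimes.

(** * Primes of polynomial rings in arbitrary indeterminates *)

Section Kronecker.
Variable I : choiceType.
Implicit Types (m : cmonom I) (js J : seq I).

(* The exponents of the indeterminates in [js] are the digits of
   [kron_weight B js m] in base [B]. *)
Fixpoint kron_weight (B : nat) js m : nat :=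
  if js is j :: js' then (m j + B * kron_weight B js' m)%N else 0%N.

Lemma kron_weight1 B js : kron_weight B js mone = 0%N.
Proof. by elim: js => //= j js ->; rewrite cm1 muln0. Qed.

Lemma kron_weightM B js m1 m2 :
  kron_weight B js (mmul m1 m2) = (kron_weight B js m1 + kron_weight B js m2)%N.
Proof. by elim: js => //= j js ->; rewrite cmM; ring. Qed.

Lemma kron_weight_inj B js m1 m2 :
  (forall j, (m1 j < B)%N) -> (forall j, (m2 j < B)%N) ->
  kron_weight B js m1 = kron_weight B js m2 -> {in js, m1 =1 m2}.
Proof.
move=> B1 B2; elim: js => //= j js IHjs eqN.
have m12 : m1 j = m2 j.
  have := congr1 (modn^~ B) eqN.
  by rewrite /= ![(_ + B * _)%N]addnC ![(B * _)%N]mulnC !modnMDl !modn_small.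
have {}IHjs : {in js, m1 =1 m2}.
  apply: IHjs; move: eqN; rewrite m12 => /addnI/eqP.
  by rewrite eqn_pmul2l ?(leq_ltn_trans _ (B1 j)) // => /eqP.
by move=> i; rewrite inE => /orP[/eqP -> //|/IHjs].
Qed.

Lemma cmonom_le_mdeg m j : (m j <= mdeg m)%N.
Proof.
have [jm|] := boolP (j \in finsupp m); last by rewrite -cmE_eq0 => /eqP ->.
by rewrite mdegE (big_fsetD1 j) //= leq_addr.
Qed.

Lemma kron_weight_separates (s : seq (cmonom I)) :
  exists B js, {in s &, injective (kron_weight B js)}.
Proof.
pose B := (\sum_(m <- s) mdeg m).+1.
pose js := flatten [seq enum_fset (finsupp m) | m : cmonom I <- s].
exists B, js => m1 m2 m1s m2s eqN.
have ltB m j : m \in s -> (m j < B)%N.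
  move=> ms; rewrite ltnS; apply: leq_trans (cmonom_le_mdeg m j) _.
  by rewrite (big_rem m) //= leq_addr.
have m12 := kron_weight_inj (fun j => ltB _ j m1s) (fun j => ltB _ j m2s) eqN.
apply/eqP/cmP => j; have [/m12 //|jjs] := boolP (j \in js).
have nj m : m \in s -> m j = 0%N.
  move=> ms; apply/eqP; rewrite cmE_eq0; apply: contra jjs => jm.
  by apply/flatten_mapP; exists m.
by rewrite !nj.
Qed.

Definition free_of J m := all (fun j => m j == 0%N) J.

Lemma free_of1 J : free_of J mone.
Proof. by apply/allP => j _; rewrite cm1. Qed.

Lemma free_ofM J m1 m2 : free_of J (mmul m1 m2) = free_of J m1 && free_of J m2.
Proof.
rewrite /free_of -all_predI; apply: eq_all => j /=.
by rewrite cmM addn_eq0.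
Qed.

Variable R : comNzRingType.
Local Notation S := (poly_ring R I).

Definition kron_monom B js J m : {poly R} :=
  if free_of J m then 'X^(kron_weight B js m) else 0.

Lemma kron_monom_mmorphism B js J : mmorphism (kron_monom B js J).
Proof.
split=> [m1 m2|]; rewrite /kron_monom ?free_of1 ?kron_weight1 ?expr0 //.
rewrite free_ofM kron_weightM exprD.
by case: free_of; case: free_of; rewrite /= ?mulr0 ?mul0r.
Qed.

HB.instance Definition _ B js J :=
  isMultiplicative.Build _ _ (kron_monom B js J) (kron_monom_mmorphism B js J).

(* Kronecker substitution, after the indeterminates in [J] are set to [0]. *)
Definition kron B js J : {rmorphism S -> {poly R}} := mmap polyC (kron_monom B js J).

Lemma kronE B js J (f : S) : kron B js J f =
  \sum_(m <- msupp f) (if free_of J m then (mcoeff m f) *: 'X^(kron_weight B js m) else 0).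
Proof.
rewrite -[LHS]/(mmap _ _ f) mmapE; apply: eq_bigr => m _.
by rewrite mul_polyC /= /kron_monom; case: ifP => // _; rewrite scaler0.
Qed.

Lemma kronC B js J c : kron B js J (mkmalgU mone c) = c%:P.
Proof. by rewrite -[LHS]/(mmap _ _ _) mmapU /= /kron_monom free_of1 kron_weight1 mulr1. Qed.

Lemma coef_kron B js J (f : S) (m : cmonom I) :
  {in m :: enum_fset (msupp f) &, injective (kron_weight B js)} ->
  free_of J m -> (kron B js J f)`_(kron_weight B js m) = mcoeff m f.
Proof.
move=> inj freem; rewrite kronE coef_sum.
have [mf|/mcoeff_outdom fm] := boolP (m \in msupp f); last first.
  rewrite fm big_seq big1 // => m' m'f; case: ifP => _; rewrite ?coef0 //.
  rewrite coefZ coefXn; case: eqP => [eqN|_]; last by rewrite mulr0.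
  have mm' : m = m' by apply: inj eqN; rewrite inE ?eqxx ?m'f ?orbT.
  by rewrite -mm' fm mul0r.
rewrite (big_fsetD1 m) //= freem coefZ coefXn eqxx mulr1 big_seq big1 ?addr0 // => m'.
rewrite !inE => /andP[m'm m'f]; case: ifP => _; rewrite ?coef0 //.
rewrite coefZ coefXn; case: eqP => [eqN|_]; last by rewrite mulr0.
have mm' : m = m' by apply: inj eqN; rewrite inE ?eqxx ?m'f ?orbT.
by rewrite mm' eqxx in m'm.
Qed.

(* The prime of the polynomial ring generated by [P] and the indeterminates in [J]. *)
Definition ext_prime (P : set R) J : set S :=
  [set f | forall m, free_of J m -> P (mcoeff m f)].

Lemma ext_prime_kron (P : set R) J B js (f : S) : ideal P ->
  ext_prime P J f -> poly_ext P (kron B js J f).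
Proof.
move=> idP Pf i; rewrite kronE coef_sum; apply: ideal_sum => // m _.
case: ifP => [freem|_]; last by rewrite coef0; exact: ideal0.
by rewrite coefZ; apply: ideal_mulr => //; exact: Pf.
Qed.

Lemma kron_ext_prime (P : set R) J B js (f : S) :
  ideal P -> {in msupp f &, injective (kron_weight B js)} ->
  poly_ext P (kron B js J f) -> ext_prime P J f.
Proof.
move=> idP inj Pf m freem.
have [mf|/mcoeff_outdom ->] := boolP (m \in msupp f); last exact: ideal0.
rewrite -(coef_kron (B := B) (js := js) (J := J)) //.
by move=> x y; rewrite !inE => /predU1P[->|xf] /predU1P[->|yf]; apply: inj.
Qed.

Lemma ext_primeP (P : set R) J : prime_ideal P -> prime_ideal (ext_prime P J).
Proof.
move=> prP; have idP := prime_is_ideal prP.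
have prX := poly_ext_prime prP; have idX := prime_is_ideal prX.
apply/prime_idealE; split.
- apply/idealE; split=> [m _|a u v Pu Pv]; first by rewrite mcoeff0; exact: ideal0.
  have [B [js inj]] := kron_weight_separates (enum_fset (msupp (a * u + v))).
  apply: (kron_ext_prime idP inj); rewrite rmorphD rmorphM.
  by apply: (idealMD idX); exact: ext_prime_kron.
- by move=> /(_ mone (free_of1 J)); rewrite mcoeff1 eqxx; exact: (prime1 prP).
- move=> u v Puv.
  have [B [js inj]] := kron_weight_separates (enum_fset (msupp u) ++ enum_fset (msupp v)).
  have [Pu|Pv] : poly_ext P (kron B js J u) \/ poly_ext P (kron B js J v).
    by apply: (primeM prX); rewrite -rmorphM; apply: ext_prime_kron.
  + left; apply: kron_ext_prime Pu => // x y xu yu; apply: inj;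
      by rewrite mem_cat ?xu ?yu.
  + right; apply: kron_ext_prime Pv => // x y xu yu; apply: inj;
      by rewrite mem_cat ?xu ?yu orbT.
Qed.

Lemma chain_to_ext_prime n (P : set R) J : uniq J -> chain_to n P ->
  chain_to (n + size J) (ext_prime P J).
Proof.
elim: J => [|j J IHJ] /= => [_|/andP[jJ uJ] cP].
  rewrite addn0; elim: n P => [|n IHn] P cP.
    by split=> //; apply: ext_primeP; exact: chain_to_prime cP.
  have prP := chain_to_prime cP; case: cP => _ [P' cP' [P'P nPP']].
  apply: chain_toS (IHn _ cP') (ext_primeP _ prP) _.
  split=> [f P'f m fm|sub]; first exact/P'P/P'f.
  apply: nPP' => a Pa; have := sub (mkmalgU mone a) _ mone (free_of1 _).
  rewrite mcoeffUU; apply=> m _; rewrite mcoeffC mulrb.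
  by case: eqP => // _; apply: ideal0; exact: prime_is_ideal.
have prP := chain_to_prime cP; rewrite addnS.
apply: chain_toS (IHJ uJ cP) (ext_primeP _ prP) _.
split=> [f Pf m /andP[_]|]; first exact: Pf.
move=> /(_ (mkmalgU (ucm j) 1)) sub; apply: (prime1 prP).
rewrite -(mcoeffUU (ucm j) (1 : R)); apply: sub => [m /andP[mj _]|].
  rewrite mcoeffU mulrb; case: eqP => [jm|_]; last first.
    by apply: ideal0; exact: prime_is_ideal.
  by move: mj; rewrite -jm cmUU.
by apply/allP => i iJ; rewrite cmU; have [ji|//] := eqVneq j i; move: jJ; rewrite ji iJ.
Qed.

End Kronecker.

Lemma malgM_const (D : idomainType) (I : choiceType) (x y : poly_ring D I) (c : D) :
  x * y = mkmalgU mone c -> c != 0 -> x = mkmalgU mone (mcoeff mone x).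
Proof.
move=> xy c0.
have [B [js inj]] := kron_weight_separates (mone :: enum_fset (msupp x)).
have /(congr1 (kron D B js [::])) := xy.
rewrite rmorphM kronC => kxy.
have sx : (size (kron D B js [::] x) <= 1)%N.
  have := congr1 (fun p : {poly D} => size p) kxy; rewrite size_polyC c0 /=.
  have [->|kx0] := eqVneq (kron D B js [::] x) 0; first by rewrite size_poly0.
  have [->|ky0] := eqVneq (kron D B js [::] y) 0; first by rewrite mulr0 size_poly0.
  rewrite size_mul //; move: ky0; rewrite -size_poly_gt0.
  by case: (size (kron D B js [::] y)) => // b _; rewrite addnS /= => <-; exact: leq_addr.
apply/malgP => m; rewrite mcoeffC mulrb; case: eqP => [-> //|m1].
apply/eqP; rewrite mcoeff_eq0; apply/negP => mx; apply: m1.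
apply: (inj m mone); rewrite ?mem_head // ?inE ?mx ?orbT //.
rewrite kron_weight1; have mx' := mx; apply: contraTeq mx => N0; rewrite -mcoeff_eq0.
rewrite -(coef_kron (B := B) (js := js) (J := [::])) //.
  by rewrite nth_default // (leq_trans sx) // lt0n.
move=> a b; rewrite !inE => Ha Hb; apply: inj; rewrite inE.
  by case/predU1P: Ha => [->|->]; rewrite ?mx' orbT.
by case/predU1P: Hb => [->|->]; rewrite ?mx' orbT.
Qed.

(** * Generation of rings *)

Section Adjunction.

Definition eval_hom (R B : comNzRingType) (f : {rmorphism R -> B}) (u : B) :
  {rmorphism {poly R} -> B} := horner_eval u \o map_poly f.

Lemma eval_homC (R B : comNzRingType) (f : {rmorphism R -> B}) u a :
  eval_hom f u a%:P = f a.
Proof. by rewrite /= /horner_eval map_polyC hornerC. Qed.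

Lemma eval_homX (R B : comNzRingType) (f : {rmorphism R -> B}) u :
  eval_hom f u 'X = u.
Proof. by rewrite /= /horner_eval map_polyX hornerX. Qed.

Lemma adjoin (B : comNzRingType)
    (Phi : seq B -> forall R : comNzRingType, {rmorphism R -> B} -> Prop)
    (R : comNzRingType) (f : {rmorphism R -> B}) (xs : seq B) :
  (forall x l (A : comNzRingType) (g : {rmorphism A -> B}),
     Phi l A g -> Phi (x :: l) {poly A} (eval_hom g x)) ->
  Phi [::] R f ->
  exists (E : comNzRingType) (g : {rmorphism E -> B}),
    [/\ Phi xs E g, range f `<=` range g & {in xs, forall x, range g x}].
Proof.
move=> PhiS Phi0; elim: xs => [|x xs [E [g [PhiE fg gxs]]]]; first by exists R, f; split.
exists {poly E}, (eval_hom g x); split; first exact: PhiS.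
  by move=> y /fg[e _ <-]; exists e%:P; rewrite // eval_homC.
move=> y; rewrite inE => /predU1P[->|/gxs[e _ <-]]; first by exists 'X => //; exact: eval_homX.
by exists e%:P; rewrite // eval_homC.
Qed.

Definition subring_set (B : comNzRingType) (S : set B) : Prop :=
  [/\ S 1, forall x y, S x -> S y -> S (x - y) & forall x y, S x -> S y -> S (x * y)].

Definition generated_by (R B : comNzRingType) (f : {rmorphism R -> B}) (xs : seq B) :=
  forall S : set B, subring_set S ->
    range f `<=` S -> {in xs, forall x, S x} -> S = [set: B].

Section SubringSet.
Variables (B : comNzRingType) (S : set B).
Hypothesis subS : subring_set S.

Lemma subring_set0 : S 0.
Proof. by case: subS => S1 SB _; rewrite -(subrr 1); exact: SB. Qed.

Lemma subring_setD x y : S x -> S y -> S (x + y).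
Proof.
case: subS => _ SB _ Sx Sy; rewrite -[y]opprK; apply: (SB x) => //.
by rewrite -sub0r; apply: SB => //; exact: subring_set0.
Qed.

Lemma subring_setM x y : S x -> S y -> S (x * y).
Proof. by case: subS => _ _; apply. Qed.

Lemma subring_setX x n : S x -> S (x ^+ n).
Proof.
move=> Sx; elim: n => [|n IHn]; first by case: subS.
by rewrite exprS; exact: subring_setM.
Qed.

Lemma subring_set_sum (I : Type) (r : seq I) (F : I -> B) :
  (forall i, S (F i)) -> S (\sum_(i <- r) F i).
Proof. by move=> SF; elim/big_ind: _ => //; [exact: subring_set0|exact: subring_setD]. Qed.

Lemma subring_set_prod (I : Type) (r : seq I) (F : I -> B) :
  (forall i, S (F i)) -> S (\prod_(i <- r) F i).
Proof. by move=> SF; elim/big_ind: _ => //; [case: subS|exact: subring_setM]. Qed.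

End SubringSet.

Lemma range_subring (E B : comNzRingType) (g : {rmorphism E -> B}) : subring_set (range g).
Proof.
split=> [|_ _ [x _ <-] [y _ <-]|_ _ [x _ <-] [y _ <-]]; first by exists 1; rewrite ?rmorph1.
  by exists (x - y); rewrite ?rmorphB.
by exists (x * y); rewrite ?rmorphM.
Qed.

Lemma preimage_subring (E B : comNzRingType) (g : {rmorphism E -> B}) S :
  subring_set S -> subring_set (g @^-1` S).
Proof.
by move=> [S1 SB SM]; split=> [|x y Sx Sy|x y Sx Sy]; rewrite /= ?(rmorph1, rmorphB, rmorphM);
  [|exact: SB|exact: SM].
Qed.

Lemma generated_noetherian (R B : comNzRingType) (f : {rmorphism R -> B}) xs :
  noetherian R -> generated_by f xs -> noetherian B.
Proof.
move=> noethR gen.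
have [_ _ A _|//|E [g [noethE fg gxs]]] := @adjoin B (fun _ A _ => noetherian A) R f xs.
  exact: Hilbert_basis.
apply: noetherian_surj noethE => y; have := gen _ (range_subring g) fg gxs.
by move=> /seteqP[_ /(_ y I)[x _ <-]]; exists x.
Qed.

Lemma generated_chain (R B : comNzRingType) (f : {rmorphism R -> B}) xs n :
  noetherian R -> generated_by f xs -> has_chain B n -> has_chain R (n - size xs).
Proof.
move=> noethR gen cB.
have [||E [g [[noethE cE] fg gxs]]] := @adjoin B (fun l A _ => noetherian A /\
  forall n, has_chain A n -> has_chain R (n - size l)) R f xs.
- move=> x l A _ [noethA cA]; split; first exact: Hilbert_basis.
  by move=> m /(has_chain_poly noethA)/cA; rewrite /= subnS -predn_sub.
- by split=> // m; rewrite subn0.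
apply: cE; have /seteqP[_ gsurj] := gen _ (range_subring g) fg gxs.
suff pre Q : chain_to n Q -> chain_to n (g @^-1` Q).
  by case: cB => Q /pre; exists (g @^-1` Q).
elim: n Q {cB} => [|n IHn] Q cQ.
  by split=> //; apply: preimage_prime; exact: chain_to_prime cQ.
have prQ := chain_to_prime cQ; case: cQ => _ [Q' cQ' [Q'Q nQQ']].
apply: chain_toS (IHn _ cQ') (preimage_prime _ prQ) _; split=> [x|sub]; first exact: Q'Q.
by apply: nQQ' => y; have [x _ <-] := gsurj y I; exact: sub.
Qed.

Lemma poly_ring_generated (R : comNzRingType) (I : choiceType) (s : seq I) :
  (forall i, i \in s) ->
  generated_by (@mkmalgU (cmonom I) R mone : {rmorphism R -> poly_ring R I})
    [seq mkmalgU (ucm i) 1 | i <- s].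
Proof.
move=> sT S subS fS gs; apply/seteqP; split=> // x _.
have mulU (a b : R) (m m' : cmonom I) : mkmalgU (mmul m m') (a * b) =
    mkmalgU m a * mkmalgU m' b :> poly_ring R I.
  by rewrite -[RHS]/(fgmul _ _) fgmulUU.
have SU (m : cmonom I) : S (mkmalgU m 1).
  have [n] := ubnP (mdeg m); elim: n m => // n IHn m mn.
  have [->|m1] := eqVneq m mone; first by apply: fS; exists 1.
  have [i mi] : exists i, m i != 0%N.
    apply: contrapT => nom; move/eqP: m1; apply; apply/eqP/cmP => i.
    by rewrite cm1; apply/eqP/negP => mi; apply: nom; exists i; apply/negP.
  have mE : m = mmul (ucm i) (divcm m (ucm i)).
    apply/eqP/cmP => j; rewrite cmM divcmE cmU.
    have [<-|_] := eqVneq i j; last by rewrite add0n subn0.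
    by rewrite subnKC // lt0n.
  rewrite mE -[X in mkmalgU _ X]mulr1 mulU; apply: (subring_setM subS).
    by apply: gs; apply/mapP; exists i.
  apply: IHn; move: mn; rewrite [in X in (X < _)%N -> _]mE mdegM mdegU; lia.
rewrite [x]monalgE; apply: (subring_set_sum subS) => m.
have -> : mkmalgU m (mcoeff m x) = mkmalgU mone (mcoeff m x) * mkmalgU m 1 :> poly_ring R I.
  by rewrite -mulU mulr1 mul1m.
by apply: (subring_setM subS) => //; apply: fS; exists (mcoeff m x).
Qed.

Lemma finitely_generated_by (k : fieldType) (A : comNzRingType) (iota : {rmorphism k -> A}) :
  finitely_generated_algebra iota -> exists xs, generated_by iota xs.
Proof.
move=> [n [v vP]]; exists (codom v) => S subS iotaS Sv; apply/seteqP; split=> // x _.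
have [p ->] := vP x; rewrite mmapE; apply: (subring_set_sum subS) => m.
apply: (subring_setM subS); first by apply: iotaS; exists (mcoeff m p).
apply: (subring_set_prod subS) => i; apply: (subring_setX subS).
by apply: Sv; exact: codom_f.
Qed.

End Adjunction.

(** * Zariski's lemma *)

Lemma prime_avoiding (R : comNzRingType) (J T : set R) : noetherian R ->
  ideal J -> multiplicative_set T -> (forall x, J x -> ~ T x) ->
  exists Q, [/\ prime_ideal Q, J `<=` Q & forall x, Q x -> ~ T x].
Proof.
move=> noethR idJ [T1 TM] JT.
pose F := [set M | [/\ ideal M, J `<=` M & forall x, M x -> ~ T x]].
have [||M [idM JM MT] Mmax] := @noetherian_max R noethR F; first by move=> M [].
  by exists J; split.
exists M; split=> //; apply/prime_idealE; split=> // [M1|x y Mxy]; first exact: MT M1 T1.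
have meet z : ~ M z -> exists w r, M w /\ T (w + r * z).
  move=> nMz; apply: contrapT => nT; apply: nMz.
  apply: (Mmax (ideal_add M z)); [split|exact: ideal_add_sub|exact: ideal_add_gen].
  - exact: ideal_addP.
  - exact: subset_trans (@ideal_add_sub _ _ _).
  - by move=> _ [w [r [Mw ->]]] Twr; apply: nT; exists w, r.
apply: contrapT => /not_orP[/meet[w [r [Mw Twr]]] /meet[v [s [Mv Tvs]]]].
apply: MT (TM _ _ Twr Tvs).
have -> : (w + r * x) * (v + s * y) = (v + s * y) * w + (r * x * v + r * s * (x * y)) by ring.
by apply: idealMD => //; apply: idealD => //; exact: ideal_mull.
Qed.

(* For [T = [set 1]] this says that the image of [f] is a Goldman domain: its
   fraction field is obtained by inverting the single element [f c]. *)
Definition Goldman (F : comNzRingType) (T : set F) (R : comNzRingType)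
    (f : {rmorphism R -> F}) : Prop :=
  exists2 c, f c != 0 & forall r, f r != 0 ->
    exists k s t, T t /\ t * f c ^+ k = f r * f s.

Lemma map_eval_hom (R : comNzRingType) (F : fieldType) (f : {rmorphism R -> F}) u p :
  eval_hom f u p = (map_poly f p).[u].
Proof. by []. Qed.

(* If [u] is transcendental, [1 + 'X * c] divides no power of [c]. *)
Lemma Goldman_algebraic (F : fieldType) (T : set F) (R : comNzRingType)
    (f : {rmorphism R -> F}) (u : F) :
  (forall t, T t -> t != 0 /\ exists a, f a = t) ->
  Goldman T (eval_hom f u) ->
  exists2 p, map_poly f p != 0 & root (map_poly f p) u.
Proof.
move=> Tf [c c0 cP]; apply: contrapT => trans.
have evalI p : eval_hom f u p = 0 -> map_poly f p = 0.
  move=> pu; apply/eqP; apply: contrapT => /negP p0; apply: trans.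
  by exists p => //; rewrite /root -map_eval_hom pu.
set g := map_poly f c.
have g0 : g != 0 by apply: contra_neq c0 => g0; rewrite map_eval_hom -/g g0 horner0.
pose r : {poly R} := 1 + 'X * c.
have rE : map_poly f r = 1 + 'X * g by rewrite rmorphD rmorph1 rmorphM /= map_polyX.
have sr : (1 < size (map_poly f r))%N.
  rewrite rE addrC size_polyDl mulrC size_mulX //; last first.
    by rewrite size_poly1 ltnS size_poly_gt0.
  by rewrite ltnS size_poly_gt0.
have [|k [s [t [Tt tE]]]] := cP r.
  apply/eqP => /evalI r0; by rewrite r0 size_poly0 in sr.
have [t0 [a fa]] := Tf _ Tt.
have tg : t%:P * g ^+ k = map_poly f r * map_poly f s.
  apply/eqP; rewrite -subr_eq0 -fa -map_polyC /g -rmorphXn -!rmorphM -rmorphB.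
  apply/eqP/evalI; rewrite rmorphB !rmorphM rmorphXn eval_homC fa.
  by rewrite tE subrr.
have : map_poly f r %| t%:P * g ^+ k by rewrite tg dvdp_mulr.
rewrite Gauss_dvdpl; last first.
  by apply: coprimep_expr; rewrite coprimep_sym rE addrC coprimep_addl_mul coprimep1.
move=> /dvdp_leq; rewrite polyC_eq0 t0 size_polyC t0 => /(_ isT).
by rewrite leqNgt sr.
Qed.

Lemma integral_inv_clear (R : comNzRingType) (F : fieldType) (f : {rmorphism R -> F}) y :
  y != 0 -> integralOver f y ->
  exists2 e, f e != 0 & forall k, integralOver f (f e ^+ k.+1 * y ^- k).
Proof.
move=> y0 [q mon_q qy]; pose m := (size q).-1.
have sq : size q = m.+1 by rewrite prednK // size_poly_gt0 monic_neq0.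
pose p := \poly_(i < m.+1) q`_(m - i).
have [||e fe0 int_e] := @integral_clear _ _ f y^-1 p.
- apply/eqP => /(congr1 (fun g : {poly F} => g`_0)); rewrite coef0 coef_map coef_poly /= subn0.
  by rewrite -[q`_m]lead_coefE (monicP mon_q) rmorph1 => /eqP; rewrite oner_eq0.
- rewrite /root -(mulrI_eq0 _ (mulfI (expf_neq0 m y0))).
  move/rootP: qy => qy; rewrite -[X in _ == X]qy; apply/eqP.
  rewrite (@horner_coef_wide _ m.+1); last exact: (leq_trans (size_poly _ _) (size_poly _ _)).
  rewrite (@horner_coef_wide _ m.+1); last by rewrite -sq; exact: size_poly.
  rewrite mulr_sumr [RHS](reindex_inj rev_ord_inj) /=; apply: eq_bigr => i _.
  have le_im : (i <= m)%N by rewrite -ltnS.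
  rewrite !coef_map coef_poly ltn_ord /= subSS mulrCA; congr (_ * _).
  by rewrite exprVn exprB // unitfE.
exists e => // k; have := int_e 'X^k k.+1.
by rewrite size_polyXn map_polyXn hornerXn exprVn; apply.
Qed.

Lemma Goldman_descent (F : fieldType) (T : set F) (R : comNzRingType)
    (f : {rmorphism R -> F}) (u : F) :
  (forall t, T t -> t != 0 /\ exists a, f a = t) ->
  (forall t n, T t -> T (t ^+ n)) ->
  Goldman T (eval_hom f u) -> Goldman T f.
Proof.
move=> Tf TX Gu; have [p p0 pu] := Goldman_algebraic Tf Gu.
have [e fe0 int_e] := integral_clear p0 pu.
case: Gu => c; set C := eval_hom f u c => C0 cP.
pose n := size c; pose y := f e ^+ n * C.
have y0 : y != 0 by rewrite mulf_neq0 ?expf_neq0.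
have [e2 fe20 int_e2] := integral_inv_clear y0 (int_e c n (leqnn _)).
exists (e * e2) => [|r fr0]; first by rewrite rmorphM mulf_neq0.
have [|k [s [t [Tt]]]] := cP r%:P; rewrite eval_homC // => tE.
have [t0 [a fa]] := Tf _ Tt.
set S := eval_hom f u s in tE; pose N := size s.
pose A := e ^+ N * e2 ^+ k.+1 * a.
have [h mon_h hA] : integralOver f (f A / f r).
  have -> : f A / f r = f e ^+ (n * k) * ((f e ^+ N * S) * (f e2 ^+ k.+1 * y ^- k)).
    have -> : S = t * C ^+ k / f r by rewrite tE mulrC mulKf.
    rewrite /A !rmorphM !rmorphXn fa /y exprMn -exprM invfM.
    move: (expf_neq0 (n * k) fe0) (expf_neq0 k C0) fr0.
    move: (f e ^+ (n * k)) (C ^+ k) (f r) (f e ^+ N) (f e2 ^+ k.+1).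
    by move=> x1 x2 x3 x4 x5 nz1 nz2 nz3; field; rewrite nz1 nz2 nz3.
  apply: integral_mul; first by apply: integral_exp; exact: integral_id.
  by apply: integral_mul; [exact: int_e|exact: int_e2].
pose m := (size h).-1.
have sh : size h = m.+1 by rewrite prednK // size_poly_gt0 monic_neq0.
have [s' AE] : exists s', f A ^+ m = f r * f s'.
  clearbody A.
  exists (- \sum_(i < m) h`_i * A ^+ i * r ^+ (m - i).-1).
  move/rootP: hA; rewrite (@horner_coef_wide _ m.+1); last by rewrite -sh; exact: size_poly.
  rewrite big_ord_recr /= coef_map /= -[h`_m]lead_coefE (monicP mon_h) rmorph1 mul1r.
  move=> /(congr1 ( *%R (f r ^+ m))); rewrite mulr0 mulrDr mulr_sumr.
  rewrite expr_div_n mulrCA mulfV ?expf_neq0 // mulr1 => /eqP.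
  rewrite addrC addr_eq0 => /eqP ->; rewrite rmorphN mulrN rmorph_sum mulr_sumr; congr (- _).
  apply: eq_bigr => i _; have lt_im := ltn_ord i.
  rewrite coef_map !rmorphM !rmorphXn /= expr_div_n.
  have -> : f r ^+ m = f r * f r ^+ (m - i).-1 * f r ^+ i.
    by rewrite -exprS -exprD; congr (_ ^+ _); lia.
  move: (expf_neq0 i fr0); move: (f r ^+ i) => z z0.
  by move: (f r ^+ (m - i).-1) (f h`_i) (f A ^+ i) (f r) => x1 x2 x3 x4; field.
exists ((N + k.+1) * m)%N, (s' * (e ^+ k.+1 * e2 ^+ N) ^+ m), (t ^+ m).
split; first exact: TX.
rewrite exprM -exprMn [f (s' * _)]rmorphM mulrA -AE rmorphXn -exprMn; congr (_ ^+ _).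
by rewrite /A !rmorphM !rmorphXn fa exprMn !exprD; ring.
Qed.

(* A relative form of Zariski's lemma, [A] modulo [P] playing the role of the
   base field. *)
Lemma algebraic_or_larger_prime (A B : comNzRingType) (g : {rmorphism A -> B}) xs
    (P : set B) :
  noetherian B -> generated_by g xs -> prime_ideal P ->
  (exists Q, [/\ prime_ideal Q, P `<` Q & forall a, Q (g a) -> P (g a)]) \/
  (forall w, exists p : {poly A},
     (exists i, ~ P (g p`_i)) /\ P (map_poly g p).[w]).
Proof.
move=> noethB gen prP; have idP := prime_is_ideal prP.
have [?|noQ] := pselect (exists Q, [/\ prime_ideal Q, P `<` Q & forall a, Q (g a) -> P (g a)]).
  by left.
right=> w; have [F [h hP]] := residue_field prP.
have inv_mod b : ~ P b -> exists a s, ~ P (g a) /\ P (g a - b * s).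
  move=> nPb; apply: contrapT => noa; apply: noQ.
  have [|||Q [prQ PQ QT]] := @prime_avoiding B (ideal_add P b)
    [set x | ~ P x /\ range g x] noethB.
  - exact: ideal_addP.
  - split; first by split; [exact: prime1|exists 1; rewrite ?rmorph1].
    by move=> x y [Px gx] [Py gy]; split; [exact: prime_nM|exact: (subring_setM (range_subring g))].
  - move=> _ [x [s [Px ->]]] [nP [a _ ga]]; apply: noa; exists a, s.
    by rewrite ga; split=> //; rewrite mulrC addrK.
  exists Q; split=> //.
    split; first by apply: subset_trans PQ; exact: ideal_add_sub.
    by move=> QP; apply: nPb; apply: QP; apply: PQ; exact: ideal_add_gen.
  by move=> a Qa; apply: contrapT => nPa; apply: (QT _ Qa); split=> //; exists a.
pose f : {rmorphism A -> F} := h \o g.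
pose T : set F := [set t | t != 0 /\ exists a, f a = t].
have fT t : T t -> t != 0 /\ exists a, f a = t by [].
have TX t n : T t -> T (t ^+ n).
  by move=> [t0 [a fa]]; split; [exact: expf_neq0|exists (a ^+ n); rewrite rmorphXn fa].
pose fw := eval_hom f (h w).
pose Phi (l : seq F) (E : comNzRingType) (e : {rmorphism E -> F}) :=
  [/\ range f `<=` range e, Goldman T e -> Goldman T fw &
      {in l, forall x, range h x} -> range e `<=` range h].
have subh := range_subring h.
have [||E [e [[fe Ge eh] _ exs]]] := @adjoin F Phi {poly A} fw (map h xs).
- move=> x l R d [fd Gd dh]; split.
  + by move=> y /fd[z _ <-]; exists z%:P => //; exact: eval_homC.
  + move=> Gx; apply: Gd; apply: Goldman_descent Gx => // t [t0 [a fa]]; split=> //.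
    by have [z _ dz] := fd t (ex_intro2 _ _ a I fa); exists z.
  + move=> lh; have {}dh : range d `<=` range h.
      by apply: dh => y yl; apply: lh; rewrite inE yl orbT.
    have hx : range h x by apply: lh; exact: mem_head.
    move=> _ [q _ <-]; rewrite map_eval_hom horner_coef.
    apply: (subring_set_sum subh) => i.
    apply: (subring_setM subh); last exact: (subring_setX subh).
    by rewrite coef_map; apply: dh; exists q`_i.
- split=> //; first by move=> _ [a _ <-]; exists a%:P => //; exact: eval_homC.
  move=> _ _ [q _ <-]; rewrite map_eval_hom horner_coef.
  apply: (subring_set_sum subh) => i.
  apply: (subring_setM subh); first by rewrite coef_map; exists (g q`_i).
  by apply: (subring_setX subh); exists w.
have {}eh : range e `<=` range h by apply: eh => _ /mapP[x _ ->]; exists x.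
have [|q q0 qw] := @Goldman_algebraic F T A f (h w) fT.
  apply: Ge; exists 1; rewrite rmorph1 ?oner_neq0 // => r er0.
  have [b _ hb] := eh _ (ex_intro2 _ _ r I erefl).
  have nPb : ~ P b by move/hP => b0; move: er0; rewrite -hb b0 eqxx.
  have [a [s [nPa /hP]]] := inv_mod b nPb.
  rewrite rmorphB rmorphM hb => /eqP; rewrite subr_eq0 => /eqP ha.
  have [s' _ es'] : range e (h s).
    suff /seteqP[_ /(_ s I)] : h @^-1` range e = [set: B] by [].
    apply: gen; first exact: preimage_subring (range_subring e).
      by move=> _ [a' _ <-]; apply: fe; exists a'.
    by move=> x xxs; apply: exs; exact: map_f.
  exists 0%N, s', (f a); rewrite expr1n mulr1 es' -ha; split=> //; split; last by exists a.
  by apply/eqP => fa0; apply: nPa; apply/hP.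
exists q; split; last first.
  apply/hP; move/rootP: qw; rewrite (@horner_coef_wide _ (size q)) ?size_poly // => qw.
  rewrite (@horner_coef_wide _ (size q)) ?size_poly // rmorph_sum -[RHS]qw.
  by apply: eq_bigr => i _; rewrite rmorphM rmorphXn !coef_map.
apply: contrapT => noi; move/eqP: q0; apply; apply/polyP => i; rewrite coef_map coef0.
by apply/hP; apply: contrapT => nP; apply: noi; exists i.
Qed.

(** * Unit dimension *)

Section SubringType.
Variables (B : comNzRingType) (S : subringClosed B).

Definition subring_type : Type := {x : B | x \in S}.

HB.instance Definition _ := SubChoice.on subring_type.
HB.instance Definition _ := [SubChoice_isSubComNzRing of subring_type by <:].

End SubringType.

Lemma subring_set_hom (B : comNzRingType) (S : set B) : subring_set S ->
  exists (A : comNzRingType) (g : {rmorphism A -> B}), range g = S.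
Proof.
move=> [S1 SB SM].
have subS : subring_closed [in S].
  by split=> [|x y /set_mem Sx /set_mem Sy|x y /set_mem Sx /set_mem Sy]; apply: mem_set;
    [|exact: SB|exact: SM].
pose mS := GRing.isSubringClosed.Build B (fun x => x \in S) subS.
pose T : subringClosed B := HB.pack (fun x => x \in S) mS.
exists (subring_type T), (val : {rmorphism subring_type T -> B}).
apply/seteqP; split=> [_ [x _ <-]|x Sx]; first exact: set_mem (valP x).
by exists (Sub x (mem_set Sx)).
Qed.

Section UnitDimensionSets.
Variable R : comNzRingType.
Hypothesis domR : prime_ideal [set x : R | x = 0].
Local Notation W n := (@udim_set R n).
Local Notation V n := (saturation (W n)).

Lemma nilpotentE (x : R) : nilpotent x <-> x = 0.
Proof.
split=> [[n xn]|->]; last by exists 1%N; rewrite expr1.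
by apply: contrapT => x0; exact: (prime_nX domR (n := n) x0 xn).
Qed.

Lemma domain_nilradical_prime : nilradical_prime R.
Proof.
split=> [/nilpotentE|x y /nilpotentE]; first exact: (prime1 domR).
by move=> /(primeM domR)[x0|y0]; [left|right]; apply/nilpotentE.
Qed.

Lemma udim_setM n x y : W n x -> W n y -> W n (x * y).
Proof. by have [_] := udim_set_multiplicative n domain_nilradical_prime; apply. Qed.

Lemma udim_set1 n : W n 1.
Proof. by have [] := udim_set_multiplicative n domain_nilradical_prime. Qed.

Lemma udim_set_neq0 n x : W n x -> x <> 0.
Proof.
case: n => [->|n [nx _]]; first by apply/eqP; exact: oner_neq0.
by move/nilpotentE.
Qed.

Lemma saturation_neq0 n x : V n x -> x <> 0.
Proof. by move=> [y /udim_set_neq0 xy x0]; apply: xy; rewrite x0 mul0r. Qed.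

Lemma saturationM n x y : V n x -> V n y -> V n (x * y).
Proof.
by move=> [x' Wx] [y' Wy]; exists (x' * y'); rewrite mulrACA; exact: udim_setM.
Qed.

Lemma saturationN n x : V n x -> V n (- x).
Proof. by move=> [y Wxy]; exists (- y); rewrite mulrNN. Qed.

Lemma saturation_dvd n x y : V n (x * y) -> V n x.
Proof. by move=> [z Wz]; exists (y * z); rewrite mulrA. Qed.

Lemma udim_set_saturation n : W n `<=` V n.
Proof. by move=> x Wx; exists 1; rewrite mulr1. Qed.

Lemma saturation_sub n : V n `<=` W n.+1.
Proof.
move=> x Vx; split; first by move/nilpotentE; exact: saturation_neq0 Vx.
by exists [:: x]; [move=> y; rewrite inE => /eqP ->|rewrite big_seq1].
Qed.

Definition udim_subring n : set R := [set x | x = 0 \/ W n.+1 x].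

Lemma udim_subringE n (x : R) :
  udim_subring n x <-> exists2 s : seq R, {in s, forall v, V n v} & x = \sum_(v <- s) v.
Proof.
split=> [[->|[_ //]]|[s sV xE]]; first by exists [::]; rewrite ?big_nil.
have [->|x0] := eqVneq x 0; [by left|right]; split; last by exists s.
by move/nilpotentE/eqP; apply/negP.
Qed.

Lemma udim_subringP n : subring_set (udim_subring n).
Proof.
split=> [|x y /udim_subringE[s sV ->] /udim_subringE[t tV ->]|x y].
- by right; exact: udim_set1.
- apply/udim_subringE; exists (s ++ [seq - v | v <- t]).
    move=> v; rewrite mem_cat => /orP[/sV//|/mapP[w /tV Vw ->]].
    exact: saturationN.
  by rewrite big_cat big_map /= sumrN.
- by move=> [->|Wx] [->|Wy]; rewrite ?mul0r ?mulr0; [left|left|left|right; exact: udim_setM].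
Qed.

Import Localization.

Lemma unit_additive_localization n :
  W n.+1 `<=` V n -> unit_additive (localization (W n)).
Proof.
move=> WV; have multW := udim_set_multiplicative n domain_nilradical_prime.
pose L := Localization.type (W n).
have numV (x : Localization.frac (W n)) :
    is_unit (\pi_L x : localization (W n)) -> V n x.1.
  case; elim/quotW => y xy.
  have : Localization.mul (\pi_L x) (\pi_L y) = Localization.one (W n) by [].
  rewrite !piE => /eqmodP/asboolP[t]; rewrite denom_id // /= mulr1 mul1r => Wt e.
  have Wxy z : W n (z : Localization.frac (W n)).2.
    by have := Localization.fracP z; rewrite denom_id.
  exists (t * y.1); have -> : x.1 * (t * y.1) = t * (x.1 * y.1) by ring.
  by rewrite e; apply: udim_setM => //; apply: udim_setM.
elim/quotW => x; elim/quotW => y /numV Vx /numV Vy.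
have Wden (z : Localization.frac (W n)) : W n z.2.
  by have := Localization.fracP z; rewrite denom_id.
have xyE : (\pi_L x + \pi_L y : localization (W n)) = \pi_L (Localization.addf x y).
  by rewrite -[LHS]/(Localization.add _ _) !piE.
rewrite xyE; set z := Localization.addf x y.
have [z0|z0] := eqVneq z.1 0.
  right; exists 1%N; rewrite expr1.
  rewrite -[RHS]/(Localization.zero (W n)) !piE; apply: Localization.pi_eq.
  by rewrite z0 /= !mul0r.
have Vxy : V n (x.1 * y.2) /\ V n (y.1 * x.2).
  by split; apply: saturationM => //; exact: udim_set_saturation.
have [w Ww] : V n z.1.
  apply: WV; split; first by move/nilpotentE/eqP; apply/negP.
  exists [:: x.1 * y.2; y.1 * x.2]; last by rewrite big_cons big_seq1.
  by move=> v; rewrite !inE => /orP[]/eqP ->; case: Vxy.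
have dw : denom (W n) (z.1 * w) by rewrite denom_id.
left; exists (\pi_L (Localization.mkfrac (z.2 * w) dw)).
rewrite -[LHS]/(Localization.mul _ _) -[RHS]/(Localization.one (W n)) !piE.
by apply: Localization.pi_eq => /=; ring.
Qed.

End UnitDimensionSets.

(* One step down the filtration: a non-unit [w] of [W_n^-1 D] that is a sum of
   units is transcendental over the units of [W_(n-1)^-1 D] even modulo a prime
   of [W_(n+1)^-1 D], so such a prime is not maximal in [W_n^-1 D]. *)
Lemma udim_prime_step (D : idomainType) (k : fieldType) (iota : {rmorphism k -> D})
    xs (n : nat) (P : set D) (w : D) :
  noetherian D -> generated_by iota xs -> prime_ideal P ->
  (forall x, @udim_set D n.+1 x -> ~ P x) ->
  @udim_set D n.+1 w -> ~ saturation (@udim_set D n) w ->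
  exists Q, [/\ prime_ideal Q, P `<` Q & forall x, @udim_set D n x -> ~ Q x].
Proof.
move=> noethD gen prP PW Ww nVw; have idP := prime_is_ideal prP.
have domD := zero_prime D.
have iotaV a : a != 0 -> saturation (@udim_set D 0) (iota a).
  by move=> a0; exists (iota a^-1); rewrite -rmorphM mulfV // rmorph1.
have [A [g [gV gW iotag]]] : exists (A : comNzRingType) (g : {rmorphism A -> D}),
    [/\ forall a, g a <> 0 -> saturation (@udim_set D n) (g a),
        @udim_set D n `<=` range g & range iota `<=` range g].
  case: n {PW Ww nVw} => [|n].
    exists k, iota; split=> [a a0|x ->|//]; last by exists 1; rewrite ?rmorph1.
    by apply: iotaV; apply: contra_not_neq a0 => ->; rewrite rmorph0.
  have [A [g gE]] := subring_set_hom (udim_subringP domD n).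
  exists A, g; split=> [a ga|x Wx|_ [a _ <-]]; rewrite ?gE; last 1 first.
  - have [->|a0] := eqVneq a 0; first by left; rewrite rmorph0.
    right; elim: n {gE} => [|n IHn]; first by apply: saturation_sub => //; exact: iotaV.
    by apply: saturation_sub => //; exact: udim_set_saturation.
  - have : range g (g a) by exists a.
    by rewrite gE => -[//|]; exact: udim_set_saturation.
  - by right.
have geng : generated_by g xs.
  by move=> S subS gS; apply: gen => //; exact: subset_trans gS.
have gP a : P (g a) -> g a = 0.
  move=> Pa; apply: contrapT => /gV/(saturation_sub domD) Wa; exact: PW Wa Pa.
have [[Q [prQ PQ Qg]]|alg] := algebraic_or_larger_prime noethD geng prP.
  exists Q; split=> // x Wx Qx; have [a _ ga] := gW _ Wx.
  apply: (PW x); last by rewrite -ga; apply: Qg; rewrite ga.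
  by apply: saturation_sub => //; exact: udim_set_saturation.
have [p [nzp Pp]] := alg w.
have {}nzp : exists i, g p`_i != 0.
  have [i Pi] := nzp; exists i; apply: contra_not_neq Pi => ->; exact: ideal0.
case: (ex_minnP nzp) => j gj jmin.
have jp : (j < size p)%N.
  by rewrite ltnNge; apply: contra gj => /(nth_default 0) ->; rewrite rmorph0.
pose z i := if (j <= i)%N then g p`_i * w ^+ (i - j) else 0.
have Pz : P (\sum_(i < size p) z i).
  apply: (primeMl prP (prime_nX prP (n := j) (PW _ Ww))).
  move: Pp; rewrite (@horner_coef_wide _ (size p)) ?size_poly // mulr_sumr.
  congr (P _); apply: eq_bigr => i _; rewrite coef_map /z; case: leqP => [le_ji|lt_ij].
    by rewrite mulrCA -exprD subnKC.
  rewrite mulr0; apply/eqP; rewrite mulf_eq0 -[g _ == 0]negbK.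
  by rewrite (contra (jmin i)) // -ltnNge.
have subD := udim_subringP domD n.
have Zz i : udim_subring n (z i).
  rewrite /z; case: ifP => _; last by left.
  apply: (subring_setM subD); last by apply: (subring_setX subD); right.
  have [g0|/eqP/gV gi] := eqVneq (g p`_i) 0; first by left.
  by right; exact: saturation_sub.
have z0 : \sum_(i < size p) z i = 0.
  have [//|Wz] := subring_set_sum subD (index_enum _) (fun i : 'I_(size p) => Zz i).
  by case: (PW _ Wz).
pose r := \sum_(i < size p | i != Ordinal jp)
  if (j <= i)%N then g p`_i * w ^+ (i - j).-1 else 0.
have zE : \sum_(i < size p) z i = g p`_j + w * r.
  rewrite (bigD1 (Ordinal jp)) //= {1}/z leqnn subnn expr0 mulr1 mulr_sumr; congr (_ + _).
  apply: eq_bigr => i ij; rewrite /z; case: leqP => [le_ji|_]; last by rewrite mulr0.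
  have ji : (j < i)%N by rewrite ltn_neqAle le_ji andbT eq_sym.
  by rewrite mulrCA -exprS prednK // subn_gt0.
case: nVw; apply: (@saturation_dvd _ n w (- r)).
have -> : w * - r = g p`_j.
  by apply/eqP; rewrite mulrN eq_sym -addr_eq0 -zE z0.
by apply: gV; exact/eqP.
Qed.

Lemma udim_chain (D : idomainType) (k : fieldType) (iota : {rmorphism k -> D}) xs n :
  noetherian D -> generated_by iota xs ->
  (forall i, (i < n)%N -> ~ @udim_set D i.+1 `<=` saturation (@udim_set D i)) ->
  has_chain D n.
Proof.
move=> noethD gen nWV.
suff : forall j, (j <= n)%N -> exists P : set D,
    chain_to j P /\ forall x, @udim_set D (n - j) x -> ~ P x.
  by move=> /(_ n (leqnn n))[P [cP _]]; exists P.
elim=> [_|j IHj lt_jn].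
  exists [set x | x = 0]; split; first by split=> //; exact: zero_prime.
  by move=> x /(udim_set_neq0 (zero_prime D)).
have [P [cP PW]] := IHj (ltnW lt_jn).
rewrite -[(n - j)%N]prednK ?subn_gt0 // -subnS in PW.
have lt_in : (n - j.+1 < n)%N by lia.
have [w [Ww nVw]] : exists w, @udim_set D (n - j.+1).+1 w /\
    ~ saturation (@udim_set D (n - j.+1)) w.
  apply: contrapT => now; apply: nWV lt_in _ => w Ww.
  by apply: contrapT => nVw; apply: now; exists w.
have [Q [prQ PQ QW]] := udim_prime_step noethD gen (chain_to_prime cP) PW Ww nVw.
by exists Q; split=> //; exact: chain_toS cP prQ PQ.
Qed.

Section PolynomialRingUnitDimension.
Variables (D : idomainType) (I : choiceType).
Local Notation S := (poly_ring D I).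
Let C : {rmorphism D -> S} := @mkmalgU (cmonom I) D mone.

Lemma poly_ring_zero_prime : prime_ideal [set f : S | f = 0].
Proof.
have : prime_ideal (@ext_prime I D [set x | x = 0] [::]).
  by apply: ext_primeP; exact: zero_prime.
congr prime_ideal; apply/predeqP => f; split=> [f0|-> m _]; last exact: mcoeff0.
by apply/malgP => m; rewrite mcoeff0; exact: f0.
Qed.

Lemma poly_ringC_inj : injective C.
Proof. exact: can_inj (@malgCK (cmonom I) D). Qed.

Lemma saturation_poly_ring n : @udim_set S n = C @` @udim_set D n ->
  saturation (@udim_set S n) = C @` saturation (@udim_set D n).
Proof.
move=> WE; apply/seteqP; split=> [x [y]|_ [a [b Wab] <-]].
  rewrite WE => -[w Ww xy].
  have w0 : w != 0 by apply/eqP; exact: (udim_set_neq0 (zero_prime D) Ww).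
  have xE := malgM_const (esym xy) w0.
  have yE := malgM_const (etrans (mulrC y x) (esym xy)) w0.
  exists (mcoeff mone x); last exact: esym xE.
  exists (mcoeff mone y); suff <- : w = mcoeff mone x * mcoeff mone y by [].
  apply: poly_ringC_inj; rewrite rmorphM xy {1}xE {1}yE; reflexivity.
by exists (C b); rewrite -rmorphM WE; exists (a * b).
Qed.

Lemma udim_set_poly_ring n : @udim_set S n = C @` @udim_set D n.
Proof.
have domS := poly_ring_zero_prime; have domD := zero_prime D.
elim: n => [|n IHn].
  apply/seteqP; split=> [x ->|_ [a -> <-]]; last by rewrite rmorph1.
  by exists 1; rewrite ?rmorph1.
have VE := saturation_poly_ring IHn.
apply/seteqP; split=> [x [/nilpotentE x0 [s sV xs]]|_ [a [/nilpotentE a0 [s sV as_]] <-]].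
  have [t tV st] : exists2 t : seq D, {in t, forall v, saturation (@udim_set D n) v} &
      s = map C t.
    elim: s sV {xs} => [|v s IHs] sV; first by exists [::].
    have [t tV ->] : exists2 t : seq D,
        {in t, forall v, saturation (@udim_set D n) v} & s = map C t.
      by apply: IHs => u us; apply: sV; rewrite inE us orbT.
    have := sV v (mem_head _ _); rewrite VE => -[a Va <-].
    by exists (a :: t) => // u; rewrite inE => /predU1P[->|/tV].
  have xE : x = C (\sum_(v <- t) v) by rewrite xs st rmorph_sum big_map.
  exists (\sum_(v <- t) v) => //; split; last by exists t.
  move=> /(nilpotentE domD) t0; apply: (x0 domS); rewrite xE t0; exact: rmorph0.
split; first by move=> /(nilpotentE domS) Ca0; apply: (a0 domD);
  apply: poly_ringC_inj; rewrite Ca0 rmorph0.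
exists (map C s); last by rewrite as_ rmorph_sum big_map.
by move=> _ /mapP[v /sV Vv ->]; rewrite VE; exists v.
Qed.

Lemma udim_poly_ring_le (k : fieldType) (iota : {rmorphism k -> D}) :
  finitely_generated_algebra iota -> (udim S <= krull_dim D)%E.
Proof.
move=> /finitely_generated_by[xs gen].
have noethD := generated_noetherian (@noetherian_field k) gen.
have [[n [-> _ nmax]]|[-> _]] := krull_dim_cases (zero_prime D); last exact: leey.
have [i [le_in addS]] : exists i, (i <= n)%N /\
    unit_additive (localization (@udim_set S i)).
  apply: contrapT => noi; suff /nmax : has_chain D n.+1 by rewrite ltnn.
  apply: udim_chain noethD gen _ => i le_in WV; apply: noi; exists i; split=> //.
  apply: (unit_additive_localization poly_ring_zero_prime).
  rewrite saturation_poly_ring ?udim_set_poly_ring // => _ [a Wa <-].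
  by exists a => //; exact: WV.
apply: le_trans (infimum_nat_le addS) _.
by rewrite lee_fin lez_nat.
Qed.

End PolynomialRingUnitDimension.

Local Open Scope ereal_scope.

Lemma krull_dim_poly_ring_ge (D : idomainType) (I : choiceType) :
  krull_dim D + ecard I <= krull_dim (poly_ring D I).
Proof.
have [[m [-> _ Smax]]|[-> _]] := krull_dim_cases (@poly_ring_zero_prime D I);
  last by rewrite leey.
have bound n (s : seq I) : uniq s -> has_chain D n -> (n + size s <= m)%N.
  by move=> us [P cP]; apply: Smax; exists (ext_prime P s); exact: chain_to_ext_prime.
have cD0 : has_chain D 0 by exists [set x | x = 0%R]; split=> //; exact: zero_prime.
have [[n [-> cn _]]|[_ cD]] := krull_dim_cases (zero_prime D); last first.
  by have := bound m.+1 [::] isT (cD _); rewrite addn0 ltnn.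
have [[s [us _ ->]]|[_ infI]] := ecard_cases I.
  by rewrite -EFinD lee_fin -PoszD lez_nat; exact: bound.
have [s [us sm]] := infI m.+1.
by have := bound 0%N s us cD0; rewrite sm add0n ltnn.
Qed.

Lemma krull_dim_poly_ring_le (D : idomainType) (I : choiceType) : noetherian D ->
  krull_dim (poly_ring D I) <= krull_dim D + ecard I.
Proof.
move=> noethD.
have [[n [-> _ nmax]]|[-> _]] := krull_dim_cases (zero_prime D); last first.
  by have [[s [_ _ ->]]|[-> _]] := ecard_cases I; rewrite leey.
have [[s [_ sI ->]]|[-> _]] := ecard_cases I; last by rewrite leey.
have gen := @poly_ring_generated D I s sI.
have bound m : has_chain (poly_ring D I) m -> (m <= n + size s)%N.
  by move=> /(generated_chain noethD gen)/nmax; rewrite size_map leq_subLR addnC.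
have [[m [-> cm _]]|[_ cS]] := krull_dim_cases (@poly_ring_zero_prime D I).
  by rewrite -EFinD lee_fin -PoszD lez_nat; exact: bound.
by have := bound _ (cS (n + size s).+1); rewrite ltnn.
Qed.

Theorem corollary6p9 (D : idomainType) (Lambda : choiceType) :
  krull_dim D + ecard Lambda <= krull_dim (poly_ring D Lambda) /\
  (noetherian D ->
     krull_dim (poly_ring D Lambda) = krull_dim D + ecard Lambda) /\
  (forall (k : fieldType) (iota : {rmorphism k -> D}),
     finitely_generated_algebra iota ->
     udim (poly_ring D Lambda) + ecard Lambda
       <= krull_dim (poly_ring D Lambda)).
Proof.
have dimS := krull_dim_poly_ring_ge D Lambda; split=> //; split=> [noethD|k iota fgD].
  by apply/eqP; rewrite eq_le dimS andbT; exact: krull_dim_poly_ring_le.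
by apply: le_trans dimS; apply: leeD => //; exact: udim_poly_ring_le fgD.
Qed.
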